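(* For $\lambda\in\mathbb{C}$ let $\mathbf{P}(\lambda)$ be the differential operator on spinor-valued tempered distributions $$\mathbf{P}(\lambda)\varphi=(n-2\lambda+1)\partial_n\varphi+\mathsf{D}(e_n\cdot\varphi)+\Delta(x_n\varphi).$$ The operator $\mathbf{P}(\lambda)$ is a spectral shift operator for the distribution kernels $\mathbf{K}^\pm_{\lambda,\nu}(x',x_n)$, i.e. $$\mathbf{P}(\lambda)\mathbf{K}^\pm_{\lambda,\nu}(x',x_n)=(\lambda+\nu-n)(\nu-\lambda+1)\,\mathbf{K}^\mp_{\lambda-1,\nu}(x',x_n).$$
   Context: Let $n\ge 2$, $\lambda,\nu\in\mathbb{C}$, $x=(x',x_n)\in\mathbb{R}^n$ with $x'\in\mathbb{R}^{n-1}$, and let $e_1,\dots,e_n$ be the standard basis. $\Sigma_n$ is the (trivial) spinor bundle of Euclidean $\mathbb{R}^n$ associated with the irreducible spin representation $\mathbb{S}_n$ for $n$ odd and with the half-spin representation $\mathbb{S}_n^+$ for $n$ even (as usual, a product of an odd number of Clifford multiplications is understood as Clifford multiplication on the spinor module). Clifford multiplication is denoted $\cdot$ and is normalized by $x\cdot y+y\cdot x=-2\langle x,y\rangle$. A point $x\in\mathbb{R}^n$ is also regarded as the vector $\sum_k x_ke_k$. The Dirac operator is $\mathsf{D}\varphi=\sum_{k=1}^n e_k\cdot\partial_k\varphi$ and $\Delta=\sum_{k=1}^n\partial_k^2$. Put $$K^+_{\lambda,\nu}(x',x_n)=|x_n|^{\lambda+\nu-n}(|x'|^2+x_n^2)^{-\nu},\qquad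 K^-_{\lambda,\nu}(x',x_n)=\mathrm{sgn}(x_n)|x_n|^{\lambda+\nu-n}(|x'|^2+x_n^2)^{-\nu},$$ and define the endomorphism-valued kernels $$\mathbf{K}^\pm_{\lambda,\nu}(x',x_n)=K^\pm_{\lambda-\frac12,\nu+\frac12}(x',x_n)\,x\cdot .$$ They are locally integrable for $\Re(\lambda+\nu)>n-1$ and $\Re(\lambda-\nu)>0$, and are understood as distributions depending meromorphically on $(\lambda,\nu)\in\mathbb{C}^2$; identities between them are identities of such meromorphic families. Differential operators act on an endomorphism-valued distribution by composing with its values (equivalently, by applying the operator to its value on each constant spinor). Upper (respectively lower) signs correspond. *)

(* Defs.v *)
From HB Require Import structures.
From mathcomp Require Import all_boot all_order all_algebra.
From mathcomp Require Import complex.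
From mathcomp Require Import all_classical all_reals all_analysis.

Set Implicit Arguments.
Unset Strict Implicit.
Unset Printing Implicit Defensive.

Import Order.TTheory GRing.Theory Num.Theory.
Import numFieldNormedType.Exports.

Local Open Scope classical_set_scope.
Local Open Scope complex_scope.
Local Open Scope ring_scope.

Section LebesgueRn.
Context {R : realType}.

Definition tuple_cons n (x : R * n.-tuple R) : n.+1.-tuple R :=
  [the n.+1.-tuple R of x.1 :: x.2].

Definition tuple_uncons n (t : n.+1.-tuple R) : R * n.-tuple R :=
  (tnth t ord0, [tuple of behead t]).

Lemma tuple_consK n : cancel (@tuple_cons n) (@tuple_uncons n).
Proof.
case=> x t; rewrite /tuple_uncons /tuple_cons; congr (_, _).
exact: val_inj.
Qed.

Lemma tuple_unconsK n : cancel (@tuple_uncons n) (@tuple_cons n).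
Proof. by move=> t; rewrite /tuple_cons /tuple_uncons /= [RHS]tuple_eta. Qed.

Lemma measurable_tuple_cons n :
  measurable_fun [set: R * n.-tuple R] (@tuple_cons n).
Proof. exact: measurable_cons. Qed.

Lemma measurable_tuple_uncons n :
  measurable_fun [set: n.+1.-tuple R] (@tuple_uncons n).
Proof.
apply: measurable_fun_pair; first exact: measurable_tnth.
exact: measurable_behead.
Qed.

Section Step.
Variables (n : nat) (mu : {sigma_finite_measure set (n.-tuple R) -> \bar R}).

Definition lebesgue_step : set (n.+1.-tuple R) -> \bar R :=
  fun A => (lebesgue_measure \x mu)%E (@tuple_cons n @^-1` A).

Let lebesgue_step0 : lebesgue_step set0 = 0%E.
Proof. by rewrite /lebesgue_step preimage_set0 measure0. Qed.

Let lebesgue_step_ge0 A : (0 <= lebesgue_step A)%E.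
Proof. exact: measure_ge0. Qed.

Let lebesgue_step_sigma_additive : semi_sigma_additive lebesgue_step.
Proof.
move=> F mF tF mUF; rewrite /lebesgue_step preimage_bigcup.
apply: measure_semi_sigma_additive.
- by move=> k; rewrite -[X in measurable X]setTI; exact: measurable_tuple_cons.
- apply/trivIsetP => /= i j _ _ ij; rewrite -preimage_setI.
  by move/trivIsetP : tF => /(_ _ _ _ _ ij) ->//; rewrite preimage_set0.
- rewrite -preimage_bigcup -[X in measurable X]setTI.
  exact: measurable_tuple_cons.
Qed.

HB.instance Definition _ := isMeasure.Build _ _ _ lebesgue_step
  lebesgue_step0 lebesgue_step_ge0 lebesgue_step_sigma_additive.

Let lebesgue_step_sigma_finite : sigma_finite setT lebesgue_step.
Proof.
have /sigma_finiteP[F [TF ndF Foo]] := sigma_finiteT (@lebesgue_measure R).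
have /sigma_finiteP[G [TG ndG Goo]] := sigma_finiteT mu.
exists (fun k => @tuple_uncons n @^-1` (F k `*` G k)).
  rewrite -preimage_bigcup predeqE => t; split=> // _ /=.
  have [i _ Fi] : (\bigcup_k F k) (tnth t ord0) by rewrite -TF.
  have [j _ Gj] : (\bigcup_k G k) [tuple of behead t] by rewrite -TG.
  exists (maxn i j) => //; split.
    by move: Fi; exact/subsetPset/ndF/leq_maxl.
  by move: Gj; exact/subsetPset/ndG/leq_maxr.
move=> k; have [mF Fk] := Foo k; have [mG Gk] := Goo k; split.
  rewrite -[X in measurable X]setTI.
  by apply: measurable_tuple_uncons => //; exact: measurableX.
rewrite /lebesgue_step -comp_preimage (_ : _ \o _ = id); last first.
  by apply/funext => x /=; rewrite tuple_consK.
by rewrite preimage_id product_measure1E// lte_mul_pinfty// ge0_fin_numE.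
Qed.

HB.instance Definition _ :=
  Measure_isSigmaFinite.Build _ _ _ lebesgue_step lebesgue_step_sigma_finite.
End Step.

(* n-fold product of the Lebesgue measure of R, on n-tuples, which carry the
   product sigma-algebra *)
Fixpoint lebesgue_Rn n : {sigma_finite_measure set (n.-tuple R) -> \bar R} :=
  match n with
  | 0 => \d_([tuple] : 0.-tuple R)
  | n'.+1 => lebesgue_step (lebesgue_Rn n')
  end.

Definition integral_Rn n (f : 'rV[R]_n -> R[i]) : R[i] :=
  Rintegral (lebesgue_Rn n) setT
    (fun t => complex.Re (f (\row_k tnth t k))) +i*
  Rintegral (lebesgue_Rn n) setT
    (fun t => complex.Im (f (\row_k tnth t k))).

End LebesgueRn.

Section Distributions.
Context {R : realType}.
Variable n : nat.
Local Notation C := R[i].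
Local Notation Rn := 'rV[R]_n.
Implicit Types (phi psi : Rn -> C).

Definition partial (k : 'I_n) phi : Rn -> C := fun x =>
  'D_(delta_mx 0 k) (fun y => complex.Re (phi y)) x +i*
  'D_(delta_mx 0 k) (fun y => complex.Im (phi y)) x.

Definition partials (s : seq 'I_n) phi : Rn -> C := foldr partial phi s.

Definition smooth phi : Prop := forall (s : seq 'I_n) (x : Rn),
  differentiable (fun y => complex.Re (partials s phi y)) x /\
  differentiable (fun y => complex.Im (partials s phi y)) x.

(* p_m(phi) <= M for the m-th Schwartz seminorm
   p_m(phi) = sup { (1 + |x|)^m |d^s phi(x)| : x in R^n, |s| <= m };
   |x| is the sup norm of row vectors, s a list of directions *)
Definition seminorm_le (m : nat) phi (M : R) : Prop :=
  forall (s : seq 'I_n) (x : Rn), (size s <= m)%N ->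
    ((1 + `|x|) ^+ m)%:C * `|partials s phi x| <= M%:C.

Definition schwartz phi : Prop :=
  smooth phi /\ forall m, exists M, seminorm_le m phi M.

(* Only the values on Schwartz functions are meaningful. The target 'M_(N, d)
   is the space of spinors for d = 1 and of endomorphisms of the spinor module
   for d = N. *)
Definition functional (N d : nat) := (Rn -> C) -> 'M[C]_(N, d).

Definition tempered N d (T : functional N d) : Prop :=
  (forall (a : C) phi psi, schwartz phi -> schwartz psi ->
     T (fun x => a * phi x + psi x) = a *: T phi + T psi) /\
  (exists (m : nat) (A : R), forall phi (M : R),
     schwartz phi -> seminorm_le m phi M ->
     forall i j, `|T phi i j| <= (A * M)%:C).

Section Operations.
Variables N d : nat.
Implicit Type T : functional N d.

Definition dist_partial (k : 'I_n) T : functional N d :=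
  fun phi => - T (partial k phi).

Definition dist_coord (k : 'I_n) T : functional N d :=
  fun phi => T (fun x => (x 0 k)%:C * phi x).

Definition dist_scale (a : C) T : functional N d := fun phi => a *: T phi.

Definition dist_add T T' : functional N d := fun phi => T phi + T' phi.

Definition dist_laplace T : functional N d :=
  fun phi => \sum_k dist_partial k (dist_partial k T) phi.

Definition dist_mul (A : 'M[C]_N) T : functional N d := fun phi => A *m T phi.

Definition dist_dirac (gamma : 'I_n -> 'M[C]_N) T : functional N d :=
  fun phi => \sum_k dist_mul (gamma k) (dist_partial k T) phi.

End Operations.

End Distributions.
Arguments functional : clear implicits.

Section Meromorphic.
Context {R : realType}.
Local Notation C := R[i].

Definition polydisc (l0 v0 : C) (r : R) (l v : C) : Prop :=
  `|l - l0| < r%:C /\ `|v - v0| < r%:C.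

(* f is the sum, near (l0, v0), of an absolutely convergent power series *)
Definition analytic_at (f : C -> C -> C) (l0 v0 : C) : Prop :=
  exists (a : nat -> nat -> C) (r M : R),
    [/\ 0 < r,
        forall K : nat,
          \sum_(i < K) \sum_(j < K) `|a i j| * (r ^+ (i + j))%:C <= M%:C &
        forall h k : C, `|h| < r%:C -> `|k| < r%:C ->
          (fun K : nat =>
             \sum_(i < K) \sum_(j < K) a i j * h ^+ i * k ^+ j : C^o)
            @ \oo --> (f (l0 + h) (v0 + k) : C^o)].

Definition holomorphic_in (D : C -> C -> Prop) (f : C -> C -> C) : Prop :=
  forall l v, D l v -> analytic_at f l v.

(* the denominators of meromorphic functions; their zero sets are nowhere
   dense because a polydisc is connected *)
Definition denominator (D : C -> C -> Prop) (g : C -> C -> C) : Prop :=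
  holomorphic_in D g /\ exists l v, D l v /\ g l v != 0.

Variables n N d : nat.

Definition holomorphic_family (D : C -> C -> Prop)
    (F : C -> C -> functional R n N d) : Prop :=
  (forall l v, D l v -> tempered (F l v)) /\
  (forall phi i j, schwartz phi ->
     holomorphic_in D (fun l v => F l v phi i j)).

(* Locally T = F / g with F a holomorphic family and g a holomorphic function;
   where every such g vanishes the value of T is junk. *)
Definition meromorphic_family (T : C -> C -> functional R n N d) : Prop :=
  forall l0 v0 : C, exists (r : R) (g : C -> C -> C)
      (F : C -> C -> functional R n N d),
    [/\ 0 < r,
        denominator (polydisc l0 v0 r) g,
        holomorphic_family (polydisc l0 v0 r) F &
        forall l v, polydisc l0 v0 r l v -> g l v != 0 ->
          forall phi, schwartz phi -> T l v phi = (g l v)^-1 *: F l v phi].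

(* equality of meromorphic families: equality off the zero set of some
   nonzero holomorphic function, locally *)
Definition meromorphic_eq (S T : C -> C -> functional R n N d) : Prop :=
  forall l0 v0 : C, exists (r : R) (g : C -> C -> C),
    [/\ 0 < r,
        denominator (polydisc l0 v0 r) g &
        forall l v, polydisc l0 v0 r l v -> g l v != 0 ->
          forall phi, schwartz phi -> S l v phi = T l v phi].

End Meromorphic.

Section Spinors.
Context {R : realType}.
Variables n N : nat.
Local Notation C := R[i].
Implicit Type gamma : 'I_n -> 'M[C]_N.

(* [gamma k] is the Clifford multiplication by e_k on the spinor module C^N
   of column vectors. Transposing turns invariant subspaces of columns into
   row spaces. *)
Definition irreducible_clifford_module gamma : Prop :=
  [/\ (0 < N)%N,
      forall j k, gamma j *m gamma k + gamma k *m gamma j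
                  = (- 2 * (j == k)%:R)%:M &
      forall U : 'M[C]_N, (forall k, stablemx U (gamma k)^T) ->
        U = 0 \/ row_full U].

Definition clifford gamma (x : 'rV[R]_n) : 'M[C]_N :=
  \sum_k (x 0 k)%:C *: gamma k.

(* i^(n/2) e_1 ... e_n, an involution for n even *)
Definition chirality gamma : 'M[C]_N :=
  'i%C ^+ n./2 *: \big[mulmx/1%:M]_(k < n) gamma k.

(* Projection of the spinor module onto the fibre of the spinor bundle: the
   whole module for n odd, the half-spin module (+1 eigenspace of the
   chirality) for n even. Hom(fibre, module) is identified with the
   endomorphisms A of the module such that A *m spinor_proj = A. *)
Definition spinor_proj gamma : 'M[C]_N :=
  if odd n then 1%:M else 2^-1 *: (1%:M + chirality gamma).

End Spinors.

Section Kernels.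
Context {R : realType}.
Variables m N : nat.
Local Notation n := m.+1.
Local Notation C := R[i].
Variable gamma : 'I_n -> 'M[C]_N.

Definition cexp (z : C) : C :=
  (expR (complex.Re z))%:C * (cos (complex.Im z) +i* sin (complex.Im z)).

(* t^z for t > 0; the value at t = 0 only matters on null sets *)
Definition cpow (t : R) (z : C) : C := cexp (z * (ln t)%:C).

Definition lastc (x : 'rV[R]_n) : R := x 0 ord_max.

Definition sqnorm' (x : 'rV[R]_n) : R :=
  \sum_(k < m) x 0 (widen_ord (leqnSn m) k) ^+ 2.

(* true is the sign +, false the sign - *)
Definition kernel (s : bool) (l v : C) (x : 'rV[R]_n) : C :=
  (if s then 1 else Num.sg (lastc x))%:C
  * cpow `|lastc x| (l + v - n%:R) * cpow (sqnorm' x + lastc x ^+ 2) (- v).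

Definition spinor_kernel (s : bool) (l v : C) (x : 'rV[R]_n) : 'M[C]_N :=
  kernel s (l - 2^-1) (v + 2^-1) x *: (clifford gamma x *m spinor_proj gamma).

Definition kernel_functional (s : bool) (l v : C) : functional R n N N :=
  fun phi => \matrix_(i, j)
    integral_Rn (fun x => spinor_kernel s l v x i j * phi x).

(* T is the meromorphic continuation of the kernels from the domain where they
   are locally integrable *)
Definition kernel_family (s : bool) (T : C -> C -> functional R n N N) :
    Prop :=
  meromorphic_family T /\
  forall l v : C,
    n%:R - 1 < complex.Re (l + v) -> 0 < complex.Re (l - v) ->
    forall phi, schwartz phi -> T l v phi = kernel_functional s l v phi.

Definition spectral_shift (d : nat) (l : C) (T : functional R n N d) :
    functional R n N d :=
  dist_add (dist_scale (n%:R - 2 * l + 1) (dist_partial ord_max T))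
    (dist_add (dist_dirac gamma (dist_mul (gamma ord_max) T))
       (dist_laplace (dist_coord ord_max T))).

End Kernels.

(* Main.v *)
(**
Both sides are meromorphic families, so it is enough to compare them near one
real point and to continue. Take lambda, nu real with a = lambda + nu - n and
b = - (nu + 1/2) both large. Then the kernel is u(x) x with u = sgn^e(x_n)
|x_n|^a |x|^(2b) twice continuously differentiable and of polynomial growth, the
pairing with a Schwartz function is an absolutely convergent integral, and
integration by parts moves the operator onto the kernel. Pointwise, with
X = x . and x e_n x = |x|^2 e_n - 2 x_n x and sum_k e_k e_n e_k = (n - 2) e_n,

  D(e_n u x)   = (- a u / x_n - 4 b x_n u / |x|^2) X + (2 b + n - 2) u e_n,
  Delta(x_n u x) = x Delta(x_n u) + 2 grad(x_n u),

and the coefficients of e_n and of x_n u / |x|^2 X cancel, which leaves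
a (nu - lambda + 1) (u / x_n) X.

For the continuation, a convergent double power series restricted to a real line
either vanishes near a point or has no zero in a punctured neighbourhood of it.
This gives the identity theorem along segments of a polydisc, and then, by
connectedness of [0, 1], along the segment from the real base point to any
other. After multiplication by the denominators of the two families their
difference is analytic, and it vanishes at the real points near the base point.
*)

Require Import Defs.
From mathcomp Require Import all_boot all_order all_algebra.
From mathcomp Require Import complex.
From mathcomp Require Import all_classical all_reals all_analysis.
From mathcomp Require Import measurable_realfun.
From mathcomp Require Import ring lra.

Set Implicit Arguments.
Unset Strict Implicit.
Unset Printing Implicit Defensive.

Import Order.TTheory GRing.Theory Num.Theory.
Import numFieldNormedType.Exports.

Local Open Scope classical_set_scope.
Local Open Scope complex_scope.
Local Open Scope ring_scope.

(** A family equals [F / g] only off the zeros of [g], and [g] is given only locally. So equality is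
    transported through analytic functions of the form [g (S - T)], and each cancellation of a
    denominator is itself an application of the identity theorem: analytic functions on a polydisc
    form an integral domain. Real parameters are chosen because the kernel is then a combination of
    constant matrices with real coefficient functions, so that only real powers need to be
    differentiated. The price is to recover a complex neighbourhood from a real one, and this is
    done on homogeneous parts of the power series. Large exponents make the kernel regular across
    the hyperplane and at the origin, hence integration by parts has boundary terms only at
    infinity, where Schwartz decay removes them. Quotients such as u / x_n or u / |x|^2 are never
    formed: they are the same functions with a lowered exponent and a flipped parity, which also
    explains the exchange of the two signs in the theorem. The half-spin projection multiplies on
    the right and the operator acts on the left, so it is carried along as a constant factor. *)

Notation cnorm := Normc.normc.

(** * Power series in two complex variables *)

Section ComplexNorm.
Context {R : realType}.
Local Notation C := R[i].
Implicit Types z w : C.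

Lemma cnormE z : `|z| = (cnorm z)%:C. Proof. by []. Qed.

Lemma gtc0R (x : R) : (0 < x%:C :> C) = (0 < x).
Proof. exact: ltcR. Qed.

Lemma cnorm_ge0 z : 0 <= cnorm z.
Proof. by case: z => a b; exact: sqrtr_ge0. Qed.

Lemma cnorm_gt0 z : (0 < cnorm z) = (z != 0).
Proof. by rewrite -gtc0R -cnormE normr_gt0. Qed.

Lemma cnorm_real (x : R) : cnorm x%:C = `|x|.
Proof. by rewrite /Normc.normc/= expr0n/= addr0 sqrtr_sqr. Qed.

Lemma cnormM z w : cnorm (z * w) = cnorm z * cnorm w.
Proof. exact: Normc.normcM. Qed.

Lemma cnormX z k : cnorm (z ^+ k) = cnorm z ^+ k.
Proof. by apply: complexI; rewrite rmorphXn/= -!cnormE normrX. Qed.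

Lemma cnormN z : cnorm (- z) = cnorm z.
Proof. by apply: complexI; rewrite -!cnormE normrN. Qed.

Lemma cnormD z w : cnorm (z + w) <= cnorm z + cnorm w.
Proof. by rewrite -lecR rmorphD/= -!cnormE ler_normD. Qed.

Lemma cnorm_sum (I : Type) (s : seq I) (P : pred I) (F : I -> C) :
  cnorm (\sum_(i <- s | P i) F i) <= \sum_(i <- s | P i) cnorm (F i).
Proof. by rewrite -lecR rmorph_sum/= -!cnormE ler_norm_sum. Qed.

Lemma cvgCP (u : nat -> C^o) (l : C) :
  (u @ \oo --> (l : C^o)) <->
  (forall e : R, 0 < e -> \forall K \near \oo, cnorm (l - u K) < e).
Proof.
rewrite cvgrPdist_lt; split => h e e0.
  have := h e%:C; rewrite gtc0R => /(_ e0); apply: filterS => K.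
  by rewrite cnormE ltcR.
(* In the partial order of C a positive element is real, so a complex radius is a real one. *)
have eE : e = (complex.Re e)%:C by rewrite RRe_real// gtr0_real.
have := e0; rewrite eE gtc0R => /h; apply: filterS => K.
by rewrite cnormE [in X in _ < X]eE ltcR.
Qed.

Lemma cvgC_le (u : nat -> C^o) (l c : C) (B : R) :
  (u @ \oo --> (l : C^o)) -> (\forall K \near \oo, cnorm (u K - c) <= B) ->
  cnorm (l - c) <= B.
Proof.
move=> /cvgCP ul uB; apply/ler_addgt0Pr => e e0.
have [K [lt le]] := filter_ex (filterI (ul _ e0) uB).
rewrite (_ : l - c = (l - u K) + (u K - c)); last by rewrite addrA subrK.
rewrite (le_trans (cnormD _ _))// addrC lerD// ltW//.
Qed.

End ComplexNorm.

Section PowerSeries.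
Context {R : realType}.
Local Notation C := R[i].
Implicit Types (a b : nat -> nat -> C) (h k : C) (r : R).

Definition psum a K h k : C :=
  \sum_(i < K) \sum_(j < K) a i j * h ^+ i * k ^+ j.

Definition asum a K r : R :=
  \sum_(i < K) \sum_(j < K) cnorm (a i j) * r ^+ (i + j).

(** Moves the bounds from the partial order of C to [R], where all later estimates take place. *)
Lemma analytic_atP (f : C -> C -> C) l v : analytic_at f l v <->
  exists a r M, [/\ 0 < r, forall K, asum a K r <= M &
    forall h k, cnorm h < r -> cnorm k < r ->
      (fun K => psum a K h k : C^o) @ \oo --> (f (l + h) (v + k) : C^o)].
Proof.
have E a (r : R) K :
    \sum_(i < K) \sum_(j < K) `|a i j| * (r ^+ (i + j))%:C = (asum a K r)%:C.
  rewrite /asum rmorph_sum/=; apply: eq_bigr => i _.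
  rewrite rmorph_sum/=; apply: eq_bigr => j _.
  by rewrite rmorphM.
split=> -[a [r [M [r0 aM cv]]]]; exists a, r, M; split => //.
- by move=> K; have := aM K; rewrite E lecR.
- by move=> h k hr kr; apply: cv; rewrite cnormE ltcR.
- by move=> K; rewrite E lecR.
- by move=> h k; rewrite !cnormE !ltcR; exact: cv.
Qed.

Lemma asum_le a K r r' : 0 <= r -> r <= r' -> asum a K r <= asum a K r'.
Proof.
move=> r0 rr'; apply: ler_sum => i _; apply: ler_sum => j _.
by rewrite ler_wpM2l ?cnorm_ge0// lerXn2r// nnegrE (le_trans r0).
Qed.

Lemma analytic_shift (f : C -> C -> C) d l v :
  analytic_at f (l + d) v -> analytic_at (fun l v => f (l + d) v) l v.
Proof.
move=> [a [r [M [r0 aM cv]]]]; exists a, r, M; split; [exact: r0|exact: aM|].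
by move=> h k hr kr; have := cv h k hr kr; rewrite addrAC.
Qed.

(** A polynomial in the increments is its own expansion, with radius 1 chosen arbitrarily. The
    constants and the two coordinate functions are the generators used later. *)
Lemma analytic_fin (f : C -> C -> C) l v a (n : nat) :
  (forall i j, (n <= i)%N || (n <= j)%N -> a i j = 0) ->
  (forall h k, f (l + h) (v + k) = psum a n h k) -> analytic_at f l v.
Proof.
move=> a0 fE.
have S (T : nmodType) (F : nat -> nat -> T) K :
    (forall i j, (n <= i)%N || (n <= j)%N -> F i j = 0) -> (n <= K)%N ->
    \sum_(i < K) \sum_(j < K) F i j = \sum_(i < n) \sum_(j < n) F i j.
  move=> F0 nK; rewrite (big_ord_widen K (fun i => \sum_(j < n) F i j) nK).
  rewrite [RHS]big_mkcond/=; apply: eq_bigr => i _.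
  case: ltnP => ni; last by apply: big1 => j _; rewrite F0// ni.
  rewrite (big_ord_widen K (F i) nK) [RHS]big_mkcond/=.
  apply: eq_bigr => j _; case: ltnP => nj//; by rewrite F0// nj orbT.
apply/analytic_atP; exists a, 1, (asum a n 1); split => //.
  move=> K; have [nK|Kn] := leqP n K.
    rewrite /asum (S _ (fun i j => cnorm (a i j) * 1 ^+ (i + j)))//.
    by move=> i j ij; rewrite a0// Normc.normc0 mul0r.
  rewrite /asum (big_ord_widen n (fun i => \sum_(j < K) cnorm (a i j) * 1 ^+ (i + j)) (ltnW Kn)).
  rewrite big_mkcond/=; apply: ler_sum => i _.
  have h0 j : 0 <= cnorm (a i j) * 1 ^+ (i + j) by rewrite expr1n mulr1 cnorm_ge0.
  case: ifP => _; last by apply: sumr_ge0 => j _.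
  rewrite (big_ord_widen n (fun j => cnorm (a i j) * 1 ^+ (i + j)) (ltnW Kn)).
  by rewrite big_mkcond/=; apply: ler_sum => j _; case: ifP.
move=> h k _ _; apply/cvgCP => e e0; exists n => // K /= nK.
rewrite fE /psum (S _ (fun i j => a i j * h ^+ i * k ^+ j) K)//.
  by rewrite subrr Normc.normc0.
by move=> i j ij; rewrite a0// !mul0r.
Qed.

Lemma analytic_cst (c : C) l v : analytic_at (fun _ _ => c) l v.
Proof.
apply: (@analytic_fin _ _ _ (fun i j => if (i == 0) && (j == 0) then c else 0) 1).
  by move=> [|i] [|j].
by move=> h k; rewrite /psum !big_ord1/= !mulr1.
Qed.

Lemma analytic_fst l v : @analytic_at R (fun l _ => l) l v.
Proof.
apply: (@analytic_fin _ _ _ (fun i j => if j == 0 then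
   (if i == 0 then l else if i == 1 then 1 else 0) else 0) 2).
  by move=> [|[|i]] [|[|j]].
move=> h k; rewrite /psum !big_ord_recl !big_ord0/= !expr0 !expr1 !addr0.
by rewrite !mulr1 !mul0r mul1r !addr0.
Qed.

Lemma analytic_snd l v : @analytic_at R (fun _ v => v) l v.
Proof.
apply: (@analytic_fin _ _ _ (fun i j => if i == 0 then
   (if j == 0 then v else if j == 1 then 1 else 0) else 0) 2).
  by move=> [|[|i]] [|[|j]].
move=> h k; rewrite /psum !big_ord_recl !big_ord0/= !expr0 !expr1 !addr0.
by rewrite !mulr1 !mul0r mul1r !addr0.
Qed.

Lemma analytic_add (f g : C -> C -> C) l v :
  analytic_at f l v -> analytic_at g l v ->
  analytic_at (fun l v => f l v + g l v) l v.
Proof.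
move=> /analytic_atP[a [r [M [r0 aM acv]]]] /analytic_atP[b [s [N [s0 bN bcv]]]].
apply/analytic_atP; exists (fun i j => a i j + b i j), (Num.min r s), (M + N).
have m0 : 0 < Num.min r s by rewrite lt_min r0.
split => //.
  move=> K; apply: (@le_trans _ _ (asum a K (Num.min r s) + asum b K (Num.min r s))).
    rewrite /asum -big_split/=; apply: ler_sum => i _.
    rewrite -big_split/=; apply: ler_sum => j _.
    by rewrite -mulrDl ler_wpM2r ?cnormD// exprn_ge0// ltW.
  apply: lerD.
    by apply: le_trans (aM K); apply: asum_le; [exact: ltW|rewrite ge_min lexx].
  by apply: le_trans (bN K); apply: asum_le; [exact: ltW|rewrite ge_min lexx orbT].
move=> h k; rewrite !lt_min => /andP[hr hs] /andP[kr ks].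
rewrite (_ : (fun K => _) = (fun K => psum a K h k + psum b K h k : C^o)).
  by apply: cvgD; [exact: acv|exact: bcv].
apply/funext => K; rewrite /psum -big_split/=; apply: eq_bigr => i _.
by rewrite -big_split/=; apply: eq_bigr => j _; rewrite !mulrDl.
Qed.

End PowerSeries.

(** * Products of double power series *)

Section Cauchy.
Context {R : realType}.
Local Notation C := R[i].
Implicit Types (a b : nat -> nat -> C) (h k : C) (r : R).

Lemma widen2 (T : nmodType) (G : nat -> nat -> T) n K : (n <= K)%N ->
  \sum_(p < n) \sum_(q < n) G p q =
  \sum_(p < K) \sum_(q < K) if (p < n)%N && (q < n)%N then G p q else 0.
Proof.
move=> nK; rewrite (big_ord_widen K (fun p => \sum_(q < n) G p q) nK).
rewrite big_mkcond/=; apply: eq_bigr => p _; case: ifP => pn /=; last by rewrite big1.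
by rewrite (big_ord_widen K (G p) nK) big_mkcond.
Qed.

Lemma sum_triangle (T : nmodType) (G : nat -> nat -> T) K :
  \sum_(i < K) \sum_(p < i.+1) G p (i - p)%N =
  \sum_(p < K) \sum_(q < K) if (p + q < K)%N then G p q else 0.
Proof.
under eq_bigr => i _.
  rewrite (big_ord_widen K (fun p => G p (i - p)%N) (ltn_ord i)) big_mkcond/=.
  over.
rewrite exchange_big/=; apply: eq_bigr => p _.
transitivity (\sum_(q < K - p) G p q).
  rewrite -(big_mkord xpredT (fun q => G p q)).
  rewrite -(big_mkord xpredT (fun i => if (p < i.+1)%N then G p (i - p)%N else 0)).
  rewrite (@big_cat_nat _ _ _ p)//=; last exact: ltnW.
  rewrite big1_seq ?add0r; last first.
    by move=> i; rewrite mem_index_iota => /andP[_ /andP[_ ip]]; rewrite ltnS leqNgt ip.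
  rewrite -{1}[nat_of_ord p]add0n big_addn; apply: eq_bigr => i _.
  by rewrite ltnS leq_addl addnK.
rewrite (big_ord_widen K (G p) (leq_subr _ _)) big_mkcond/=.
by apply: eq_bigr => q _; rewrite ltn_subRL.
Qed.

(** [p] and [p'] are the powers of the first variable taken from the two factors, [q] and [q'] those
    of the second. The index set is a mask [P] on a full box, so that sums over different sets
    compare term by term. *)
Definition sum4 (T : nmodType) K (P : nat -> nat -> nat -> nat -> bool)
    (W : nat -> nat -> nat -> nat -> T) : T :=
  \sum_(p < K) \sum_(p' < K) \sum_(q < K) \sum_(q' < K)
    if P p p' q q' then W p p' q q' else 0.

Lemma sum4_triangle (T : nmodType) (W : nat -> nat -> nat -> nat -> T) K :
  \sum_(i < K) \sum_(j < K) \sum_(p < i.+1) \sum_(q < j.+1)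
    W p (i - p)%N q (j - q)%N =
  sum4 K (fun p p' q q' => (p + p' < K)%N && (q + q' < K)%N) W.
Proof.
under eq_bigr => i _.
  rewrite exchange_big/=.
  under eq_bigr => p _ do rewrite (sum_triangle (W p (i - p)%N)).
  over.
rewrite (sum_triangle (fun p p' => \sum_(q < K) \sum_(q' < K)
  if (q + q' < K)%N then W p p' q q' else 0)).
apply: eq_bigr => p _; apply: eq_bigr => p' _; case: ifP => pp' /=.
  by apply: eq_bigr.
by rewrite big1// => i _; rewrite big1.
Qed.

Lemma sum4_sub K (P Q : nat -> nat -> nat -> nat -> bool) (W : nat -> nat -> nat -> nat -> R) :
  (forall p p' q q', 0 <= W p p' q q') ->
  (forall p p' q q', P p p' q q' -> Q p p' q q') -> sum4 K P W <= sum4 K Q W.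
Proof.
move=> W0 PQ; do 4! (apply: ler_sum => ? _).
by case: ifPn => [/PQ->//|_]; case: ifP.
Qed.

Lemma sum4B (T : zmodType) K (P : nat -> nat -> nat -> nat -> bool) (W : nat -> nat -> nat -> nat -> T) :
  sum4 K (fun _ _ _ _ => true) W - sum4 K P W =
  sum4 K (fun p p' q q' => ~~ P p p' q q') W.
Proof.
rewrite /sum4; do 4! (rewrite -sumrB; apply: eq_bigr => ? _).
by case: ifP => _ /=; rewrite ?subrr ?subr0.
Qed.

Lemma sum4_widen (T : nmodType) n K (W : nat -> nat -> nat -> nat -> T) :
  (n <= K)%N -> sum4 n (fun _ _ _ _ => true) W =
  sum4 K (fun p p' q q' => [&& (p < n)%N, (p' < n)%N, (q < n)%N & (q' < n)%N]) W.
Proof.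
move=> nK; rewrite /sum4.
rewrite (widen2 (fun p p' => \sum_(q < n) \sum_(q' < n) W p p' q q') nK).
apply: eq_bigr => p _; apply: eq_bigr => p' _.
case: ltnP => _ /=; last by rewrite big1// => q _; rewrite big1.
case: ltnP => _ /=; last by rewrite big1// => q _; rewrite big1.
by rewrite (widen2 (W p p') nK).
Qed.

Lemma cnorm_sum4 K (P : nat -> nat -> nat -> nat -> bool) (W : nat -> nat -> nat -> nat -> C)
    (W' : nat -> nat -> nat -> nat -> R) :
  (forall p p' q q', cnorm (W p p' q q') <= W' p p' q q') ->
  cnorm (sum4 K P W) <= sum4 K P W'.
Proof.
move=> h; do 4! (apply: le_trans (cnorm_sum _ _ _) _; apply: ler_sum => ? _).
by case: ifP => _; rewrite ?Normc.normc0.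
Qed.

Definition cauchy a b i j : C :=
  \sum_(p < i.+1) \sum_(q < j.+1) a p q * b (i - p)%N (j - q)%N.

Definition monomial4 a b h k p p' q q' : C :=
  (a p q * h ^+ p * k ^+ q) * (b p' q' * h ^+ p' * k ^+ q').

Definition rmonomial4 a b r p p' q q' : R :=
  (cnorm (a p q) * r ^+ (p + q)) * (cnorm (b p' q') * r ^+ (p' + q')).

Lemma psum_cauchy a b K h k : psum (cauchy a b) K h k =
  sum4 K (fun p p' q q' => (p + p' < K)%N && (q + q' < K)%N) (monomial4 a b h k).
Proof.
rewrite -sum4_triangle; apply: eq_bigr => i _; apply: eq_bigr => j _.
rewrite /cauchy !mulr_suml; apply: eq_bigr => p _.
rewrite !mulr_suml; apply: eq_bigr => q _.
have -> : h ^+ i = h ^+ p * h ^+ (i - p) by rewrite -exprD subnKC// -ltnS.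
have -> : k ^+ j = k ^+ q * k ^+ (j - q) by rewrite -exprD subnKC// -ltnS.
rewrite /monomial4; ring.
Qed.

Lemma psumM a b K h k : psum a K h k * psum b K h k =
  sum4 K (fun _ _ _ _ => true) (monomial4 a b h k).
Proof.
rewrite /psum big_distrlr/=; apply: eq_bigr => p _; apply: eq_bigr => p' _.
by rewrite big_distrlr.
Qed.

Lemma asumM a b K r : asum a K r * asum b K r =
  sum4 K (fun _ _ _ _ => true) (rmonomial4 a b r).
Proof.
rewrite /asum big_distrlr/=; apply: eq_bigr => p _; apply: eq_bigr => p' _.
by rewrite big_distrlr.
Qed.

Lemma rmonomial4_ge0 a b r p p' q q' : 0 <= r -> 0 <= rmonomial4 a b r p p' q q'.
Proof.
by move=> r0; rewrite !mulr_ge0// ?cnorm_ge0// exprn_ge0.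
Qed.

(** After the triangle inequality the left side runs over the quadruples with [p + p' < K] and
    [q + q' < K], a subset of the box of the product, and all terms are nonnegative. *)
Lemma asum_cauchy_le a b K r : 0 <= r ->
  asum (cauchy a b) K r <= asum a K r * asum b K r.
Proof.
move=> r0; rewrite asumM.
apply: (@le_trans _ _ (sum4 K
  (fun p p' q q' => (p + p' < K)%N && (q + q' < K)%N) (rmonomial4 a b r))).
  rewrite -sum4_triangle; apply: ler_sum => i _; apply: ler_sum => j _.
  apply: le_trans (ler_wpM2r _ (cnorm_sum _ _ _)) _; first exact: exprn_ge0.
  rewrite mulr_suml; apply: ler_sum => p _.
  apply: le_trans (ler_wpM2r _ (cnorm_sum _ _ _)) _; first exact: exprn_ge0.
  rewrite mulr_suml; apply: ler_sum => q _.
  have -> : r ^+ (i + j) = r ^+ (p + q) * r ^+ ((i - p) + (j - q)).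
    by rewrite -exprD addnACA !subnKC// -ltnS.
  rewrite cnormM /rmonomial4 le_eqVlt; apply/orP; left; apply/eqP; ring.
by apply: sum4_sub => // *; exact: rmonomial4_ge0.
Qed.

(* The square partial sums of the product series miss only terms outside the
   box of half size, whose absolute sum is a Cauchy difference. *)
Lemma psum_cauchy_err a b K h k r : 0 <= r -> cnorm h <= r -> cnorm k <= r ->
  cnorm (psum a K h k * psum b K h k - psum (cauchy a b) K h k) <=
  asum a K r * asum b K r - asum a K./2 r * asum b K./2 r.
Proof.
move=> r0 hr kr; rewrite psumM psum_cauchy sum4B.
apply: le_trans (cnorm_sum4 (W' := rmonomial4 a b r) _ _ _) _.
  move=> p p' q q'; rewrite /monomial4 /rmonomial4 !cnormM !cnormX !exprD !mulrA.
  have hX n : cnorm h ^+ n <= r ^+ n by rewrite lerXn2r// nnegrE cnorm_ge0.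
  have kX n : cnorm k ^+ n <= r ^+ n by rewrite lerXn2r// nnegrE cnorm_ge0.
  by do ! (apply: ler_pM; rewrite ?mulr_ge0 ?exprn_ge0 ?cnorm_ge0//).
rewrite -sum4B -asumM lerD2l lerN2 asumM.
have K2 : (K./2 <= K)%N by rewrite -[leqRHS]odd_double_half -addnn addnA leq_addl.
rewrite (sum4_widen _ K2).
apply: sum4_sub => [*|p p' q q' /and4P[pK p'K qK q'K]]; first exact: rmonomial4_ge0.
have E i j : (i < K./2)%N -> (j < K./2)%N -> (i + j < K)%N.
  move=> iK jK; rewrite -[X in (_ < X)%N]odd_double_half -addnn.
  by rewrite (leq_trans (_ : _ < K./2 + K./2)%N) ?leq_addl// -addSn leq_add// ltnW.
by rewrite !E.
Qed.

Lemma cvg_asum a r M : 0 <= r -> (forall K, asum a K r <= M) ->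
  exists l : R, asum a K r @[K --> \oo] --> l.
Proof.
move=> r0 aM; suff : cvgn (fun K => asum a K r) by move/cvg_ex.
apply: nondecreasing_is_cvgn; last by exists M => _ [K _ <-].
apply/nondecreasing_seqP => K; rewrite /asum (widen2 (fun i j => cnorm (a i j) * r ^+ (i + j)) (leqnSn K)).
apply: ler_sum => i _; apply: ler_sum => j _; case: ifP => // _.
by rewrite mulr_ge0 ?cnorm_ge0// exprn_ge0.
Qed.

Lemma cvg_half (u : nat -> R) (l : R) : u @ \oo --> l -> u K./2 @[K --> \oo] --> l.
Proof.
move=> ul; apply: (cvg_comp _ _ _ ul) => A [n _ nA].
exists n.*2 => //= K nK; apply: nA => /=.
by rewrite -(doubleK n) half_leq.
Qed.

(** The absolute partial sums of both factors converge, so their product taken at [K] and at [K./2]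
    has one limit. The difference, which bounds the error of the Cauchy product by
    [psum_cauchy_err], tends to 0. *)
Lemma analytic_mul (f g : C -> C -> C) l v :
  analytic_at f l v -> analytic_at g l v ->
  analytic_at (fun l v => f l v * g l v) l v.
Proof.
move=> /analytic_atP[a [ra [M [ra0 aM acv]]]].
move=> /analytic_atP[b [rb [N [rb0 bN bcv]]]].
pose r := Num.min ra rb.
have r0 : 0 < r by rewrite lt_min ra0.
have {}aM K : asum a K r <= M.
  by apply: le_trans (aM K); apply: asum_le; [exact: ltW|rewrite ge_min lexx].
have {}bN K : asum b K r <= N.
  by apply: le_trans (bN K); apply: asum_le; [exact: ltW|rewrite ge_min lexx orbT].
have as0 c K : 0 <= asum c K r.
  by do 2! (apply: sumr_ge0 => ? _); rewrite mulr_ge0 ?cnorm_ge0// exprn_ge0// ltW.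
apply/analytic_atP; exists (cauchy a b), r, (M * N); split => //.
  by move=> K; apply: le_trans (asum_cauchy_le _ _ _ (ltW r0)) _; exact: ler_pM.
move=> h k; rewrite !lt_min => /andP[ha hb] /andP[ka kb].
have [A Acv] := cvg_asum (ltW r0) aM; have [B Bcv] := cvg_asum (ltW r0) bN.
have Dcv : asum a K r * asum b K r - asum a K./2 r * asum b K./2 r
    @[K --> \oo] --> (0 : R).
  have A2 := cvg_half Acv; have B2 := cvg_half Bcv.
  by rewrite -(subrr (A * B)); exact: cvgB (cvgM Acv Bcv) (cvgM A2 B2).
have Pcv : (fun K => psum a K h k * psum b K h k : C^o) @ \oo -->
    (f (l + h) (v + k) * g (l + h) (v + k) : C^o).
  by apply: cvgM; [exact: acv|exact: bcv].
apply/cvgCP => e e0; have e20 : 0 < e / 2 by rewrite divr_gt0.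
move/cvgCP : Pcv => /(_ _ e20) Pcv.
move/cvgrPdist_lt : Dcv => /(_ _ e20) Dcv.
apply: filterS2 Pcv Dcv => K P D.
set u := f _ _ * _ in P *; set x := psum a K h k * _ in P.
rewrite (_ : u - _ = (u - x) + (x - psum (cauchy a b) K h k)); last first.
  by rewrite addrA subrK.
rewrite (le_lt_trans (cnormD _ _))// [e]splitr ltrD//.
rewrite (le_lt_trans (psum_cauchy_err _ _ _ (ltW r0) _ _))//.
- by rewrite ltW// lt_min ha.
- by rewrite ltW// lt_min ka.
by move: D; rewrite sub0r normrN => /(le_lt_trans (ler_norm _)).
Qed.

End Cauchy.

(** * The identity theorem *)

Section Taylor.
Context {R : realType}.
Local Notation C := R[i].
Implicit Types (a : nat -> nat -> C) (f g : C -> C -> C).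

(** The homogeneous part of degree [m] of the series at [(w1, w2)], that is, the coefficient of
    [s ^+ m] along the complex line with this direction. *)
Definition tcoef a m (w1 w2 : C) : C :=
  \sum_(i < m.+1) a i (m - i)%N * w1 ^+ i * w2 ^+ (m - i).

(** What remains are monomials of total degree above [m]; each is at most [q ^+ m.+1] times its
    majorant at radius [r], because [q <= 1]. *)
Lemma psum_taylor a K m (w1 w2 s : C) (q r : R) : (m < K)%N ->
  0 <= q <= 1 -> 0 <= r -> cnorm (s * w1) <= q * r -> cnorm (s * w2) <= q * r ->
  cnorm (psum a K (s * w1) (s * w2) - \sum_(k < m.+1) tcoef a k w1 w2 * s ^+ k)
    <= q ^+ m.+1 * asum a K r.
Proof.
move=> mK /andP[q0 q1] r0 hw1 hw2.
pose G i j := a i j * (s * w1) ^+ i * (s * w2) ^+ j.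
have -> : \sum_(k < m.+1) tcoef a k w1 w2 * s ^+ k =
    \sum_(p < K) \sum_(q < K) if (p + q <= m)%N then G p q else 0.
  transitivity (\sum_(k < m.+1) \sum_(i < k.+1) G i (k - i)%N).
    apply: eq_bigr => k _; rewrite /tcoef mulr_suml; apply: eq_bigr => i _.
    have -> : s ^+ k = s ^+ i * s ^+ (k - i) by rewrite -exprD subnKC// -ltnS.
    by rewrite /G !exprMn; ring.
  rewrite sum_triangle (widen2 (fun p q => if (p + q < m.+1)%N then G p q else 0) mK).
  apply: eq_bigr => i _; apply: eq_bigr => j _.
  case: (ltnP i m.+1) => im; case: (ltnP j m.+1) => jm //=; case: ifP => // ijm.
  - by move: jm; rewrite ltnNge (leq_trans (leq_addl i j) ijm).
  - by move: im; rewrite ltnNge (leq_trans (leq_addr j i) ijm).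
  - by move: im; rewrite ltnNge (leq_trans (leq_addr j i) ijm).
rewrite /psum -sumrB (le_trans (cnorm_sum _ _ _))// /asum mulr_sumr.
apply: ler_sum => i _; rewrite -sumrB (le_trans (cnorm_sum _ _ _))// mulr_sumr.
apply: ler_sum => j _; rewrite -/(G i j); case: leqP => ijm.
  by rewrite subrr Normc.normc0 !mulr_ge0 ?exprn_ge0 ?cnorm_ge0.
rewrite subr0 /G !cnormM !cnormX.
have hX (w : C) k : cnorm (s * w) <= q * r -> cnorm (s * w) ^+ k <= (q * r) ^+ k.
  by move=> hw; rewrite lerXn2r// nnegrE ?cnorm_ge0// mulr_ge0.
apply: (@le_trans _ _ (cnorm (a i j) * (q * r) ^+ i * (q * r) ^+ j)).
  rewrite -!mulrA ler_wpM2l ?cnorm_ge0//.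
  by apply: ler_pM; rewrite ?exprn_ge0 ?cnorm_ge0//; exact: hX.
rewrite -mulrA -exprD exprMn mulrCA ler_wpM2r//.
  by rewrite mulr_ge0 ?cnorm_ge0// exprn_ge0.
by rewrite ler_wiXn2l.
Qed.

(** The limit of [psum_taylor]. The constants [r] and [M] do not depend on the direction, so one
    estimate serves every line through the centre. *)
Lemma taylor f l v : analytic_at f l v ->
  exists a r M, [/\ 0 < r, 0 <= M & forall (w1 w2 s : C) (q : R), 0 <= q < 1 ->
    cnorm (s * w1) <= q * r -> cnorm (s * w2) <= q * r ->
    forall m, cnorm (f (l + s * w1) (v + s * w2) -
      \sum_(k < m.+1) tcoef a k w1 w2 * s ^+ k) <= M * q ^+ m.+1].
Proof.
move=> /analytic_atP[a [r [M [r0 aM cv]]]]; exists a, r, M.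
have M0 : 0 <= M by apply: le_trans (aM 0%N); rewrite /asum big_ord0.
split=> // w1 w2 s q /andP[q0 q1] h1 h2 m.
have qr : q * r < r by rewrite gtr_pMl.
apply: (cvgC_le (cv _ _ (le_lt_trans h1 qr) (le_lt_trans h2 qr))).
exists m.+1 => // K /= mK.
have q01 : 0 <= q <= 1 by rewrite q0 ltW.
apply: le_trans (psum_taylor a mK q01 (ltW r0) h1 h2) _.
by rewrite mulrC ler_wpM2r ?exprn_ge0.
Qed.

Lemma geometric_eq0 (x M q : R) : 0 <= q < 1 -> 0 <= x -> 0 <= M ->
  (forall m, x <= M * q ^+ m.+1) -> x = 0.
Proof.
move=> /andP[q0 q1] x0 M0 h; apply/eqP; rewrite eq_le x0 andbT.
have Mq : M * q ^+ m @[m --> \oo] --> M * 0.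
  by apply: cvgM; [exact: cvg_cst|apply: cvg_expr; rewrite ger0_norm].
rewrite mulr0 in Mq; have <- := cvg_lim (@Rhausdorff R) Mq.
apply: limr_ge; first by apply/cvg_ex; exists 0.
by exists 1%N => // -[|m] //= _; exact: h.
Qed.

(** If some homogeneous part survives in this direction, the lowest one, of degree [m], has size of
    order |s|^m and beats the remainder of order |s|^(m+1). Otherwise the remainder is the whole
    value, and letting [m] grow makes it 0 in the full disc. *)
Lemma taylor_zero f l v (a : nat -> nat -> C) (r M : R) : 0 < r -> 0 <= M ->
  (forall (w1 w2 s : C) (q : R), 0 <= q < 1 ->
    cnorm (s * w1) <= q * r -> cnorm (s * w2) <= q * r ->
    forall m, cnorm (f (l + s * w1) (v + s * w2) -
      \sum_(k < m.+1) tcoef a k w1 w2 * s ^+ k) <= M * q ^+ m.+1) ->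
  forall w1 w2 : C,
  ((forall k, tcoef a k w1 w2 = 0) /\
   forall s, cnorm (s * w1) < r -> cnorm (s * w2) < r ->
     f (l + s * w1) (v + s * w2) = 0) \/
  exists2 d : R, 0 < d &
    forall s : R, s != 0 -> `|s| < d -> f (l + s%:C * w1) (v + s%:C * w2) != 0.
Proof.
move=> r0 M0 T w1 w2.
have [c0|/existsNP[m0 /eqP cm0]] := pselect (forall k, tcoef a k w1 w2 = 0).
  left; split => // s h1 h2.
  (* The smallest ratio at which the remainder estimate applies to this [s]. *)
  pose q := Num.max (cnorm (s * w1)) (cnorm (s * w2)) / r.
  have q01 : 0 <= q < 1.
    rewrite ltr_pdivrMr// mul1r gt_max h1 h2 !andbT divr_ge0// ?(ltW r0)//.
    by rewrite le_max cnorm_ge0.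
  apply: Normc.eq0_normc.
  apply: (geometric_eq0 q01 (cnorm_ge0 _) M0) => m.
  have := T w1 w2 s q q01; rewrite /q !divfK ?gt_eqF// !le_max !lexx orbT.
  move=> /(_ isT isT m); rewrite big1 ?subr0//.
  by move=> k _; rewrite c0 mul0r.
right.
have ex : exists m, tcoef a m w1 w2 != 0 by exists m0.
have [m cm cmin] := ex_minnP ex.
have cE (s : C) : \sum_(k < m.+1) tcoef a k w1 w2 * s ^+ k =
    tcoef a m w1 w2 * s ^+ m.
  rewrite big_ord_recr/= big1 ?add0r// => k _.
  have [->|/cmin] := eqVneq (tcoef a k w1 w2) 0; first by rewrite mul0r.
  by rewrite leqNgt ltn_ord.
(* [o] dominates both components, and the added 1 keeps it positive when the direction is 0. The
   added 1 in [B] has the same purpose. *)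
pose o := cnorm w1 + cnorm w2 + 1.
have o0 : 0 < o by rewrite ltr_wpDl// addr_ge0 ?cnorm_ge0.
pose B := M * (o / r) ^+ m.+1 + 1.
have B0 : 0 < B.
  by rewrite ltr_wpDl// mulr_ge0// exprn_ge0// divr_ge0// ltW.
have c0 : 0 < cnorm (tcoef a m w1 w2) by rewrite cnorm_gt0.
exists (Num.min (r / o) (cnorm (tcoef a m w1 w2) / B)).
  by rewrite lt_min !divr_gt0.
move=> s s0; rewrite lt_min => /andP[so sB]; apply/negP => /eqP f0.
have q01 : 0 <= `|s| * o / r < 1.
  rewrite divr_ge0 ?mulr_ge0 ?normr_ge0 ?(ltW o0) ?(ltW r0)//=.
  by rewrite ltr_pdivrMr// mul1r -ltr_pdivlMr.
have w10 := cnorm_ge0 w1; have w20 := cnorm_ge0 w2.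
have := T w1 w2 s%:C _ q01; rewrite divfK ?gt_eqF// !cnormM cnorm_real.
rewrite !ler_wpM2l// ?normr_ge0 /o; [|lra|lra].
move=> /(_ isT isT m); rewrite f0 cE sub0r cnormN cnormM cnormX cnorm_real.
rewrite -/o -mulrA exprMn (exprS `|s|).
set B' := (o / r) ^+ _.
rewrite (_ : M * _ = (`|s| * (M * B')) * `|s| ^+ m); last by ring.
rewrite ler_pM2r ?exprn_gt0 ?normr_gt0// leNgt => /negP; apply.
apply: (@le_lt_trans _ _ (`|s| * B)); last by rewrite -ltr_pdivlMr.
by rewrite ler_wpM2l ?normr_ge0// /B lerDl.
Qed.

Lemma dichotomy f l v : analytic_at f l v -> forall w1 w2 : C,
  exists2 d : R, 0 < d &
    (forall s : R, `|s| < d -> f (l + s%:C * w1) (v + s%:C * w2) = 0) \/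
    (forall s : R, s != 0 -> `|s| < d -> f (l + s%:C * w1) (v + s%:C * w2) != 0).
Proof.
move=> /taylor[a [r [M [r0 M0 T]]]] w1 w2.
have [[_ f0]|[d d0 fn0]] := taylor_zero r0 M0 T w1 w2; last by exists d => //; right.
pose o := cnorm w1 + cnorm w2 + 1.
have w10 := cnorm_ge0 w1; have w20 := cnorm_ge0 w2.
have o0 : 0 < o by rewrite ltr_wpDl// addr_ge0.
exists (r / o); first by rewrite divr_gt0.
left => s; rewrite ltr_pdivlMr// => so.
apply: f0; rewrite cnormM cnorm_real; apply: le_lt_trans so;
  rewrite ler_wpM2l ?normr_ge0// /o; lra.
Qed.

(* On a real line the first nonvanishing homogeneous part of the series would
   dominate, so every homogeneous part vanishes at real points, hence as a
   polynomial: real parameters suffice to check an analytic identity. *)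
Lemma real_zero f l v : analytic_at f l v ->
  (exists2 d : R, 0 < d & forall x y : R, `|x| < d -> `|y| < d ->
    f (l + x%:C) (v + y%:C) = 0) ->
  exists2 d : R, 0 < d & forall h k : C, cnorm h < d -> cnorm k < d ->
    f (l + h) (v + k) = 0.
Proof.
move=> /taylor[a [r [M [r0 M0 T]]]] [d d0 f0].
have creal (x : R) m : tcoef a m x%:C 1 = 0.
  have [[//]|[d' d'0 fn0]] := taylor_zero r0 M0 T x%:C 1.
  (* A positive parameter so small that the real point [(s x, s)] lies where [f] vanishes and also
     where [fn0] says that it does not. *)
  pose s := Num.min d' (Num.min d (d / (`|x| + 1))) / 2.
  have x1 : 0 < `|x| + 1 by rewrite ltr_wpDl// normr_ge0.
  have mn0 : 0 < Num.min d' (Num.min d (d / (`|x| + 1))).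
    by rewrite !lt_min d'0 d0 divr_gt0.
  have s0 : 0 < s by rewrite divr_gt0.
  have : s < Num.min d' (Num.min d (d / (`|x| + 1))).
    by rewrite gtr_pMr// invf_lt1// ltr1n.
  rewrite !lt_min ltr_pdivlMr// => /and3P[sd' sd sx].
  have := fn0 s; rewrite gt_eqF// gtr0_norm// sd' => /(_ isT isT) /negP[].
  rewrite mulr1 -rmorphM/= f0 ?eqxx ?(gtr0_norm s0)//.
  rewrite normrM (gtr0_norm s0) (le_lt_trans _ sx)// ler_wpM2l ?ltW//.
  by rewrite ltrDl.
have a0 i j : a i j = 0.
  (* The part of degree [i + j] at [(x, 1)] is a polynomial in [x]. It vanishes at the [i + j + 1]
     integers 0, ..., [i + j], more than its degree allows. *)
  pose p := \poly_(k < (i + j).+1) a k (i + j - k)%N.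
  have p0 : p = 0.
    apply: contraTeq isT => pn0; have := max_poly_roots
      (rs := [seq (k%:R : C) | k <- iota 0 (i + j).+1]) pn0.
    have -> : all (root p) [seq (k%:R : C) | k <- iota 0 (i + j).+1].
      apply/allP => _ /mapP[k _ ->]; apply/rootP; rewrite horner_poly.
      rewrite -[RHS](creal k%:R (i + j)%N).
      by apply: eq_bigr => t _; rewrite expr1n mulr1 rmorph_nat.
    rewrite map_inj_uniq ?iota_uniq ?size_map ?size_iota; last first.
      by move=> x y /eqP; rewrite eqr_nat => /eqP.
    by move=> /(_ isT isT); rewrite ltnNge size_poly.
  by have := coef_poly (i + j).+1 (fun k => a k (i + j - k)%N) i; 
    rewrite -/p p0 coef0 ltnS leq_addr addnC addnK.
exists r => // h k hr kr.
have [[_ z]|[d' d'0 fn0]] := taylor_zero r0 M0 T h k.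
  by have := z 1; rewrite !mul1r; exact.
have q01 : 0 <= (2^-1 : R) < 1 by rewrite invr_ge0 ler0n invf_lt1// ltr1n.
(* With all coefficients zero the remainder is the value of [f]; at half the radius it is bounded by
   a geometric sequence of ratio 1/2. This contradicts the second alternative. *)
have Z (s : R) : cnorm (s%:C * h) <= 2^-1 * r -> cnorm (s%:C * k) <= 2^-1 * r ->
    f (l + s%:C * h) (v + s%:C * k) = 0.
  move=> sh sk; apply: Normc.eq0_normc.
  apply: (geometric_eq0 q01 (cnorm_ge0 _) M0) => m.
  have := T h k s%:C _ q01 sh sk m; rewrite big1 ?subr0// => t _.
  by rewrite /tcoef big1 ?mul0r// => u _; rewrite a0 !mul0r.
pose s := Num.min (d' / 2) (2^-1).
have s0 : 0 < s by rewrite lt_min divr_gt0//= invr_gt0 ltr0n.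
have s2 : s <= 2^-1 by rewrite ge_min lexx orbT.
have sd : s < d'.
  by rewrite gt_min gtr_pMr// invf_lt1// ltr1n.
have := fn0 s; rewrite gt_eqF// gtr0_norm// sd => /(_ isT isT) /negP[].
by rewrite Z// cnormM cnorm_real gtr0_norm// ler_pM// ?cnorm_ge0 ?ltW.
Qed.

End Taylor.

Section Identity.
Context {R : realType}.
Local Notation C := R[i].
Implicit Types f g : C -> C -> C.

(** The hypothesis says that [P] is locally constant on [0, 1]. The supremum of the [t] with [P] on
    all of [0, t] is attained, and could be passed if it were below 1. *)
Lemma unit_interval_connected (P : R -> Prop) :
  (forall t, 0 <= t <= 1 -> exists2 d : R, 0 < d &
     forall u, 0 <= u <= 1 -> `|u - t| < d -> (P t <-> P u)) ->
  P 0 -> P 1.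
Proof.
move=> locP P0.
pose A := [set t : R | 0 <= t <= 1 /\ forall u, 0 <= u <= t -> P u].
have A0 : A 0.
  split; first by rewrite lexx ler01.
  by move=> u u0; have -> : u = 0 by apply/eqP; rewrite eq_le andbC.
have hsA : has_sup A by split; [exists 0|exists 1 => t [/andP[]]].
pose s := sup A.
have s01 : 0 <= s <= 1.
  rewrite (sup_upper_bound hsA A0)/=; apply: ge_sup => //; first by exists 0.
  by move=> t [/andP[]].
have [d d0 Pd] := locP _ s01.
have [t [t01 Pt] st] := sup_adherent d0 hsA.
rewrite -/s in st; have ts : t <= s by exact: sup_upper_bound.
have Ps : P s.
  apply/(Pd t) => //; first by rewrite ltr_distl; apply/andP; split; lra.
  by apply: Pt; rewrite lexx; case/andP : t01 => ->.
have Psd u : 0 <= u <= 1 -> u < s + d -> P u.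
  move=> u01 ud; have [ut|tu] := leP u t.
    by apply: Pt; case/andP : u01 => ->.
  by apply/(Pd u) => //; rewrite ltr_distl; apply/andP; split; lra.
have [s1|s1] := ltP s 1; last first.
  by apply: Psd; [rewrite ler01 lexx|lra].
pose w := Num.min 1 (s + d / 2).
have Aw : A w.
  have w0 : 0 <= w by rewrite le_min ler01; case/andP : s01 => *; lra.
  split; first by rewrite w0 ge_min lexx.
  move=> u /andP[u0]; rewrite le_min => /andP[u1 ud].
  by apply: Psd; [rewrite u0|lra].
have := sup_upper_bound hsA Aw; rewrite -/s leNgt lt_min s1/=.
by move=> /negP[]; lra.
Qed.

Definition segment (p q : C) (t : R) : C := p + t%:C * (q - p).

Lemma segment0 p q : segment p q 0 = p.
Proof. by rewrite /segment mul0r addr0. Qed.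

Lemma segment1 p q : segment p q 1 = q.
Proof. by rewrite /segment mul1r addrC subrK. Qed.

Lemma segmentD p q t s : segment p q (t + s) = segment p q t + s%:C * (q - p).
Proof. by rewrite /segment rmorphD/= mulrDl addrA. Qed.

Lemma segment_convex (c p q : C) (r t : R) : cnorm (p - c) < r ->
  cnorm (q - c) < r -> 0 <= t <= 1 -> cnorm (segment p q t - c) < r.
Proof.
move=> pc qc /andP[t0 t1].
have -> : segment p q t - c = (1 - t)%:C * (p - c) + t%:C * (q - c).
  rewrite /segment rmorphB rmorph1; ring.
apply: le_lt_trans (cnormD _ _) _; rewrite !cnormM !cnorm_real !ger0_norm ?subr_ge0//.
have [->|t'] := eqVneq t 0; first by rewrite subr0 mul1r mul0r addr0.
have tp : 0 < t by rewrite lt_def t'.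
rewrite (_ : r = (1 - t) * r + t * r); last by ring.
by rewrite ler_ltD// ?ltr_pM2l// ler_wpM2l ?subr_ge0// ltW.
Qed.

Lemma polydiscE (l0 v0 : C) (r : R) l v :
  polydisc l0 v0 r l v <-> cnorm (l - l0) < r /\ cnorm (v - v0) < r.
Proof. by rewrite /polydisc !cnormE !ltcR. Qed.

Lemma polydisc_center (l0 v0 : C) (r : R) : 0 < r -> polydisc l0 v0 r l0 v0.
Proof. by move=> r0; apply/polydiscE; rewrite !subrr Normc.normc0. Qed.

Lemma polydisc_sub (l0 v0 l1 v1 : C) (r : R) : polydisc l0 v0 r l1 v1 ->
  exists2 e : R, 0 < e & forall l v, polydisc l1 v1 e l v -> polydisc l0 v0 r l v.
Proof.
move=> /polydiscE[h1 h2].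
exists (Num.min (r - cnorm (l1 - l0)) (r - cnorm (v1 - v0))).
  by rewrite lt_min !subr_gt0 h1.
move=> l v /polydiscE; rewrite !lt_min => -[/andP[a1 _] /andP[_ a2]].
apply/polydiscE; split.
- rewrite -(subrK l1 l) -addrA (le_lt_trans (cnormD _ _))//; lra.
- rewrite -(subrK v1 v) -addrA (le_lt_trans (cnormD _ _))//; lra.
Qed.

Lemma segment_polydisc (l0 v0 l1 v1 l2 v2 : C) (r t : R) :
  polydisc l0 v0 r l1 v1 -> polydisc l0 v0 r l2 v2 -> 0 <= t <= 1 ->
  polydisc l0 v0 r (segment l1 l2 t) (segment v1 v2 t).
Proof.
move=> /polydiscE[? ?] /polydiscE[? ?] ?.
by apply/polydiscE; split; exact: segment_convex.
Qed.

Lemma identity_segment f (D : C -> C -> Prop) (l1 v1 l2 v2 : C) :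
  holomorphic_in D f ->
  (forall t : R, 0 <= t <= 1 -> D (segment l1 l2 t) (segment v1 v2 t)) ->
  (exists2 d : R, 0 < d & forall s, 0 < s < d ->
     f (segment l1 l2 s) (segment v1 v2 s) = 0) ->
  f l2 v2 = 0.
Proof.
move=> hf DD [d d0 f0].
pose h t := f (segment l1 l2 t) (segment v1 v2 t).
(* Vanishing on a whole neighbourhood of [t] is locally constant by [dichotomy], unlike vanishing at
   [t]. At 0 the dichotomy also turns the one-sided hypothesis into a two-sided one. *)
pose P t := exists2 d : R, 0 < d & forall s, `|s| < d -> h (t + s) = 0.
have dich t : 0 <= t <= 1 -> exists2 e : R, 0 < e &
    (forall s, `|s| < e -> h (t + s) = 0) \/
    (forall s, s != 0 -> `|s| < e -> h (t + s) != 0).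
  move=> t01; have [e e0 H] := dichotomy (hf _ _ (DD _ t01)) (l2 - l1) (v2 - v1).
  exists e => //; case: H => H; [left|right] => s;
    rewrite /h !segmentD; exact: H.
have notP t e : 0 < e -> (forall s, s != 0 -> `|s| < e -> h (t + s) != 0) -> ~ P t.
  move=> e0 H [e' e'0 H']; pose s := Num.min e e' / 2.
  have m0 : 0 < Num.min e e' by rewrite lt_min e0.
  have s0 : 0 < s by rewrite divr_gt0.
  have : s < Num.min e e' by rewrite gtr_pMr// invf_lt1// ltr1n.
  rewrite lt_min => /andP[se se'].
  have := H s; rewrite gt_eqF// gtr0_norm// se => /(_ isT isT).
  by rewrite H' ?eqxx// gtr0_norm.
suff : P 1 by move=> [e e0 /(_ 0)]; rewrite normr0 addr0 /h !segment1; exact.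
apply: unit_interval_connected.
  move=> t t01; have [e e0 [H|H]] := dich t t01; exists e => // u u01 ute.
    split=> _; last by exists e.
    exists (e - `|u - t|); first by rewrite subr_gt0.
    move=> s se; rewrite (_ : u + s = t + ((u - t) + s)); last by ring.
    by apply: H; rewrite (le_lt_trans (ler_normD _ _))//; lra.
  have [->//|ut] := eqVneq u t.
  split=> [/(notP _ _ e0 H)//|].
  have u0 : 0 < `|u - t| by rewrite normr_gt0 subr_eq0.
  move=> [e' e'0 H']; have := H (u - t); rewrite subr_eq0 ut ute => /(_ isT isT).
  by rewrite addrC subrK -(addr0 u) H' ?eqxx// normr0.
have t0 : 0 <= (0 : R) <= 1 by rewrite lexx ler01.
have [e e0 [H|H]] := dich 0 t0; first by exists e.
pose s := Num.min e d / 2.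
have m0 : 0 < Num.min e d by rewrite lt_min e0.
have s0 : 0 < s by rewrite divr_gt0.
have : s < Num.min e d by rewrite gtr_pMr// invf_lt1// ltr1n.
rewrite lt_min => /andP[se sd].
have := H s; rewrite gt_eqF// gtr0_norm// se => /(_ isT isT).
by rewrite add0r /h f0 ?eqxx// s0.
Qed.

(* Along a real segment starting where [g] does not vanish, [g] has no zeros
   for small parameters, so that [f] vanishes there. *)
Lemma identity_mul f g l0 v0 (r : R) l1 v1 (e : R) :
  holomorphic_in (polydisc l0 v0 r) f -> denominator (polydisc l0 v0 r) g ->
  0 < e -> polydisc l0 v0 r l1 v1 ->
  (forall l v, polydisc l1 v1 e l v -> polydisc l0 v0 r l v ->
     f l v * g l v = 0) ->
  forall l v, polydisc l0 v0 r l v -> f l v = 0.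
Proof.
move=> hf [hg [l2 [v2 [D2 g2]]]] e0 D1 fg0 l v Dlv.
(* A starting point with [g] nonzero exists near [(l1, v1)]: otherwise [g] vanishes there, and along
   the segment to [(l2, v2)] it would vanish at a point where it is known to be nonzero. *)
have [[l3 [v3 [D3 E3 g3]]]|none] := pselect (exists l3 v3,
    [/\ polydisc l0 v0 r l3 v3, polydisc l1 v1 e l3 v3 & g l3 v3 != 0]); last first.
  suff g20 : g l2 v2 = 0 by rewrite g20 eqxx in g2.
  apply: (identity_segment hg (l1 := l1) (v1 := v1)).
    by move=> t; exact: segment_polydisc.
  pose o := cnorm (l2 - l1) + cnorm (v2 - v1) + 1.
  have w10 := cnorm_ge0 (l2 - l1); have w20 := cnorm_ge0 (v2 - v1).
  have o0 : 0 < o by rewrite ltr_wpDl// addr_ge0.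
  exists (Num.min 1 (e / o)); first by rewrite lt_min ltr01 divr_gt0.
  move=> s /andP[s0]; rewrite lt_min ltr_pdivlMr// => /andP[s1 so].
  apply: contra_notP none => /eqP gn0.
  exists (segment l1 l2 s), (segment v1 v2 s); split => //.
    by apply: segment_polydisc => //; rewrite !ltW.
  apply/polydiscE; rewrite /segment ![_ + _ - _]addrAC !subrr !add0r.
  rewrite !cnormM cnorm_real gtr0_norm//.
  by split; apply: le_lt_trans so; rewrite ler_wpM2l ?ltW// /o; lra.
have [d d0 [H|H]] := dichotomy (hg _ _ D3) (l - l3) (v - v3).
  by have := H 0; rewrite normr0 !mul0r !addr0 => /(_ d0) g0; rewrite g0 eqxx in g3.
apply: (identity_segment hf (l1 := l3) (v1 := v3)).
  by move=> t; exact: segment_polydisc.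
have [e' e'0 sub] := polydisc_sub E3.
pose o := cnorm (l - l3) + cnorm (v - v3) + 1.
have w10 := cnorm_ge0 (l - l3); have w20 := cnorm_ge0 (v - v3).
have o0 : 0 < o by rewrite ltr_wpDl// addr_ge0.
exists (Num.min (Num.min d 1) (e' / o)); first by rewrite !lt_min d0 ltr01 divr_gt0.
move=> s /andP[s0]; rewrite !lt_min ltr_pdivlMr// => /andP[/andP[sd s1] so].
have Ds : polydisc l0 v0 r (segment l3 l s) (segment v3 v s).
  by apply: segment_polydisc => //; rewrite !ltW.
have Es : polydisc l1 v1 e (segment l3 l s) (segment v3 v s).
  apply: sub; apply/polydiscE; rewrite /segment ![_ + _ - _]addrAC !subrr !add0r.
  rewrite !cnormM cnorm_real gtr0_norm//.
  by split; apply: le_lt_trans so; rewrite ler_wpM2l ?ltW// /o; lra.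
have /eqP := fg0 _ _ Es Ds; rewrite mulf_eq0 => /orP[/eqP//|gs].
have := H s; rewrite gt_eqF// gtr0_norm// sd => /(_ isT isT).
by rewrite -/(segment _ _ _) -/(segment _ _ _) gs.
Qed.

End Identity.

(** * Continuation of identities between meromorphic families *)

Section Continuation.
Context {R : realType}.
Local Notation C := R[i].

(** If [g] vanished on the smaller polydisc, cancelling it from [1 * g = 0] by [identity_mul] would
    give [1 = 0]. *)
Lemma denominator_sub g (l0 v0 l1 v1 : C) (r e : R) :
  denominator (polydisc l0 v0 r) g -> polydisc l0 v0 r l1 v1 -> 0 < e ->
  (forall l v, polydisc l1 v1 e l v -> polydisc l0 v0 r l v) ->
  denominator (polydisc l1 v1 e) g.
Proof.
move=> dg D1 e0 sub; split; first by move=> l v /sub /(proj1 dg).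
apply: contrapT => none; have : (1 : C) = 0; last by apply/eqP; exact: oner_neq0.
apply: (identity_mul (f := fun _ _ => 1) _ dg e0 D1 _ D1).
  by move=> l v _; exact: analytic_cst.
move=> l v E1 _; rewrite mul1r; apply: contra_notP none => /eqP gn0.
by exists l, v.
Qed.

(** Absence of zero divisors: if the product vanished identically, [identity_mul] would cancel [g]
    and leave [f = 0]. *)
Lemma denominator_mul (l0 v0 : C) (r : R) f g : 0 < r ->
  denominator (polydisc l0 v0 r) f -> denominator (polydisc l0 v0 r) g ->
  denominator (polydisc l0 v0 r) (fun l v => f l v * g l v).
Proof.
move=> r0 df dg; split.
  by move=> l v D; apply: analytic_mul; [exact: (proj1 df)|exact: (proj1 dg)].
apply: contrapT => none; have [hf [l [v [D]]]] := df; move/negP; apply; apply/eqP.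
apply: (identity_mul hf dg r0 (polydisc_center _ _ r0)) D => l' v' _ D'.
by apply: contra_notP none => /eqP gn0; exists l', v'.
Qed.

Lemma polydisc_le (l0 v0 : C) (r r' : R) l v : r <= r' ->
  polydisc l0 v0 r l v -> polydisc l0 v0 r' l v.
Proof.
by move=> rr' /polydiscE[? ?]; apply/polydiscE; split; exact: lt_le_trans rr'.
Qed.

Lemma polydisc_shift (l0 v0 d : C) (r : R) l v :
  polydisc (l0 + d) v0 r (l + d) v <-> polydisc l0 v0 r l v.
Proof. by rewrite /polydisc opprD addrACA subrr addr0. Qed.

Variables n N d : nat.
Implicit Types S T : C -> C -> functional R n N d.

(** The local data [F = g (S - T)] have analytic entries. Equality near a point amounts to [F = 0]
    on the polydisc, which makes it an open and closed condition on the point. *)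
Lemma continuation S T (l1 v1 : C) :
  (forall l0 v0, exists r g (F : C -> C -> functional R n N d),
    [/\ 0 < r, denominator (polydisc l0 v0 r) g,
        (forall phi i j, schwartz phi ->
           holomorphic_in (polydisc l0 v0 r) (fun l v => F l v phi i j)) &
        forall l v, polydisc l0 v0 r l v -> g l v != 0 ->
          forall phi, schwartz phi ->
            F l v phi = g l v *: (S l v phi - T l v phi)]) ->
  (exists2 e : R, 0 < e & forall x y : R, `|x| < e -> `|y| < e ->
     forall phi, schwartz phi ->
       S (l1 + x%:C) (v1 + y%:C) phi = T (l1 + x%:C) (v1 + y%:C) phi) ->
  meromorphic_eq S T.
Proof.
move=> hloc [e e0 hreal].
pose Good l0 v0 := exists (r : R) (g : C -> C -> C),
  [/\ 0 < r, denominator (polydisc l0 v0 r) g &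
    forall l v, polydisc l0 v0 r l v -> g l v != 0 ->
      forall phi, schwartz phi -> S l v phi = T l v phi].
(* On one polydisc of local data, [Good] at any single point forces [F = 0] throughout, and this
   gives [Good] at every other point. *)
have near l0 v0 : exists2 r : R, 0 < r & forall l v, polydisc l0 v0 r l v ->
    (Good l0 v0 <-> Good l v).
  have [r [g [F [r0 dg hF FE]]]] := hloc l0 v0; exists r => //.
  pose zeroF := forall l v, polydisc l0 v0 r l v ->
    forall phi, schwartz phi -> F l v phi = 0.
  have zeroF_Good : zeroF -> forall l v, polydisc l0 v0 r l v -> Good l v.
    move=> F0 l v D; have [e' e'0 sub] := polydisc_sub D.
    exists e', g; split => //; first exact: denominator_sub dg D e'0 sub.
    move=> l' v' /sub D' gn0 phi sphi; have := FE _ _ D' gn0 _ sphi.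
    rewrite F0// => /esym/eqP; rewrite scaler_eq0 (negbTE gn0) subr_eq0 => /eqP.
    exact.
  (* [F] is tied to [S - T] only off the zeros of [g], and [S = T] is known only off those of [h].
     Hence [F * g * h] vanishes on the small polydisc; first [h], then [g] is cancelled. *)
  have Good_zeroF l v : polydisc l0 v0 r l v -> Good l v -> zeroF.
    move=> D [r' [h [r'0 dh ST]]] l' v' D' phi sphi.
    apply/matrixP => i j; rewrite mxE.
    have [e1 e10 sub] := polydisc_sub D.
    pose e2 := Num.min e1 r'; have e20 : 0 < e2 by rewrite lt_min e10.
    have sub1 l2 v2 : polydisc l v e2 l2 v2 -> polydisc l0 v0 r l2 v2.
      by move=> E; apply: sub; apply: polydisc_le E; rewrite ge_min lexx.
    have sub2 l2 v2 : polydisc l v e2 l2 v2 -> polydisc l v r' l2 v2.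
      by move=> E; apply: polydisc_le E; rewrite ge_min lexx orbT.
    have dh2 := denominator_sub dh (polydisc_center _ _ r'0) e20 sub2.
    apply: (identity_mul (hF _ i j sphi) dg e20 D _ D') => l2 v2 E2 D2.
    apply: (identity_mul (f := fun l v => F l v phi i j * g l v) _ dh2 e20
      (polydisc_center _ _ e20) _ E2).
      move=> l3 v3 /sub1 D3; apply: analytic_mul; first exact: hF.
      by have [] := dg => + _; exact.
    move=> l3 v3 E3 _; have [gn0|/eqP gn0] := eqVneq (g l3 v3) 0.
      by rewrite gn0 mulr0 mul0r.
    have [hn0|/eqP hn0] := eqVneq (h l3 v3) 0; first by rewrite hn0 mulr0.
    rewrite FE//; [|exact: sub1|exact/eqP].
    rewrite (ST l3 v3)//; [|exact: sub2|exact/eqP].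
    by rewrite subrr scaler0 mxE !mul0r.
  move=> l v D; split => [G|G].
    by apply: zeroF_Good D; apply: Good_zeroF G; exact: polydisc_center.
  by apply: zeroF_Good; [exact: Good_zeroF D G|exact: polydisc_center].
have Good1 : Good l1 v1.
  have [r [g [F [r0 dg hF FE]]]] := hloc l1 v1; exists r, g; split => //.
  suff F0 phi : schwartz phi -> forall i j l v, polydisc l1 v1 r l v ->
      F l v phi i j = 0.
    move=> l v D gn0 phi sphi; have := FE _ _ D gn0 _ sphi.
    have -> : F l v phi = 0 by apply/matrixP => i j; rewrite F0// mxE.
    move=> /esym/eqP; rewrite scaler_eq0 (negbTE gn0) subr_eq0 => /eqP.
    exact.
  move=> sphi i j; have c1 := polydisc_center l1 v1 r0.
  (* The factor [g] covers the real points where [g] is zero and nothing is known about [F]. It is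
     cancelled once a complex neighbourhood is reached. *)
  have [||d' d'0 fg0] := @real_zero R (fun l v => F l v phi i j * g l v) l1 v1.
  - by apply: analytic_mul; [exact: hF|case: dg => + _; exact].
  - exists (Num.min e r); first by rewrite lt_min e0.
    move=> x y; rewrite !lt_min => /andP[xe xr] /andP[ye yr].
    have [->|gn0] := eqVneq (g (l1 + x%:C) (v1 + y%:C)) 0; first by rewrite mulr0.
    rewrite FE//.
      by rewrite hreal// subrr scaler0 mxE mul0r.
    by apply/polydiscE; rewrite ![_ + _ - _]addrAC !subrr !add0r !cnorm_real.
  apply: (identity_mul (hF _ i j sphi) dg d'0 c1) => l v /polydiscE[hl hv] _.
  by have := fg0 _ _ hl hv; rewrite ![_ + (_ - _)]addrC !subrK.
move=> l v; rewrite -/(Good l v) -(segment1 l1 l) -(segment1 v1 v).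
apply: (@unit_interval_connected R (fun t => Good (segment l1 l t) (segment v1 v t)));
  last by rewrite !segment0.
move=> t t01; have [r r0 H] := near (segment l1 l t) (segment v1 v t).
pose o := cnorm (l - l1) + cnorm (v - v1) + 1.
have w10 := cnorm_ge0 (l - l1); have w20 := cnorm_ge0 (v - v1).
have o0 : 0 < o by rewrite ltr_wpDl// addr_ge0.
exists (r / o); first by rewrite divr_gt0.
move=> u u01; rewrite ltr_pdivlMr// => uo; apply: H; apply/polydiscE.
have E p q : segment p q u - segment p q t = (u - t)%:C * (q - p).
  by rewrite /segment rmorphB; ring.
rewrite !E !cnormM cnorm_real.
by split; apply: le_lt_trans uo; rewrite ler_wpM2l ?normr_ge0// /o; lra.
Qed.

End Continuation.

(** * Schwartz functions *)

Section Schwartz.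
Context {R : realType}.
Variable n : nat.
Local Notation C := R[i].
Local Notation Rn := 'rV[R]_n.
Implicit Types (phi psi : Rn -> C) (s : seq 'I_n) (x : Rn).

Definition diffC phi x : Prop :=
  differentiable (fun y => complex.Re (phi y)) x /\
  differentiable (fun y => complex.Im (phi y)) x.

Lemma ReMr (a : R) (z : C) : complex.Re (a%:C * z) = a * complex.Re z.
Proof. by case: z => b c /=; rewrite mul0r subr0. Qed.

Lemma ImMr (a : R) (z : C) : complex.Im (a%:C * z) = a * complex.Im z.
Proof. by case: z => b c /=; rewrite mul0r addr0. Qed.

Lemma ReD (z w : C) : complex.Re (z + w) = complex.Re z + complex.Re w.
Proof. by case: z => ? ?; case: w. Qed.

Lemma ImD (z w : C) : complex.Im (z + w) = complex.Im z + complex.Im w.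
Proof. by case: z => ? ?; case: w. Qed.

Lemma complex_ext (z w : C) : complex.Re z = complex.Re w ->
  complex.Im z = complex.Im w -> z = w.
Proof. by case: z => a b; case: w => c d /= -> ->. Qed.

Lemma diffC_add phi psi x : diffC phi x -> diffC psi x ->
  diffC (fun y => phi y + psi y) x.
Proof.
move=> [h1 h2] [k1 k2]; split.
- by under eq_fun do rewrite ReD; exact: differentiableD.
- by under eq_fun do rewrite ImD; exact: differentiableD.
Qed.

Lemma diffC_coord k phi x : diffC phi x ->
  diffC (fun y => (y 0 k)%:C * phi y) x.
Proof.
move=> [h1 h2]; have hk := differentiable_coord x 0 k; split.
- by under eq_fun do rewrite ReMr; exact: differentiableM.
- by under eq_fun do rewrite ImMr; exact: differentiableM.
Qed.

Lemma partial_add j phi psi x : diffC phi x -> diffC psi x ->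
  partial j (fun y => phi y + psi y) x = partial j phi x + partial j psi x.
Proof.
move=> [h1 h2] [k1 k2]; apply: complex_ext; rewrite /partial ?ReD ?ImD/=.
- under eq_fun do rewrite ReD.
  by rewrite deriveD//; exact: diff_derivable.
- under eq_fun do rewrite ImD.
  by rewrite deriveD//; exact: diff_derivable.
Qed.

Lemma derive_coord k j x : 'D_(delta_mx 0 j) (fun y : Rn => y 0 k) x = (k == j)%:R.
Proof.
apply: cvg_lim; first exact: Rhausdorff.
apply: cvg_near_cst; near=> h.
rewrite /= !mxE/= addrK [_ *: _]mulrA mulVf ?mul1r//.
by near: h; exact: nbhs_dnbhs_neq.
Unshelve. all: by end_near. Qed.

Lemma partial_coord j k phi x : diffC phi x ->
  partial j (fun y => (y 0 k)%:C * phi y) x =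
  (k == j)%:R * phi x + (x 0 k)%:C * partial j phi x.
Proof.
move=> [h1 h2].
have hk : derivable (fun y : Rn => y 0 k) x (delta_mx 0 j).
  by apply: diff_derivable; exact: differentiable_coord.
apply: complex_ext.
  rewrite ReD ReMr -[(k == j)%:R](rmorph_nat (real_complex R)) ReMr /=.
  under eq_fun do rewrite ReMr.
  rewrite (deriveM hk (diff_derivable h1)).
  by rewrite derive_coord addrC mulrC.
rewrite ImD ImMr -[(k == j)%:R](rmorph_nat (real_complex R)) ImMr /=.
under eq_fun do rewrite ImMr.
rewrite (deriveM hk (diff_derivable h2)).
by rewrite derive_coord addrC mulrC.
Qed.

Lemma smooth_diffC phi s x : smooth phi -> diffC (partials s phi) x.
Proof. exact. Qed.

Lemma partials_rcons s k phi : partials (rcons s k) phi = partials s (partial k phi).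
Proof. by rewrite /partials foldr_rcons. Qed.

Lemma diffC_sum phi (L : seq (seq 'I_n)) x : smooth phi ->
  diffC (fun y => \sum_(s <- L) partials s phi y) x.
Proof.
move=> sp; elim: L => [|s L ih].
  under eq_fun do rewrite big_nil.
  by split; exact: differentiable_cst.
under eq_fun do rewrite big_cons.
by apply: diffC_add => //; exact: smooth_diffC.
Qed.

Lemma partial_sum j phi (L : seq (seq 'I_n)) x : smooth phi ->
  partial j (fun y => \sum_(s <- L) partials s phi y) x =
  \sum_(s <- L) partials (j :: s) phi x.
Proof.
move=> sp; elim: L => [|s L ih].
  under eq_fun do rewrite big_nil.
  by rewrite big_nil /partial; apply: complex_ext => /=; rewrite derive_cst.
under eq_fun do rewrite big_cons.
by rewrite partial_add ?ih ?big_cons//; exact: diffC_sum.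
Qed.

(** Commuting a coordinate past [partials s] produces one term for each entry of [s] equal to [k].
    The list [L] records them with multiplicity; the bounds on its length and on its entries are
    what the seminorm estimate needs. *)
Lemma partials_coord k phi s : smooth phi -> exists L : seq (seq 'I_n),
  [/\ (size L <= size s)%N, all (fun t => size t <= size s)%N L &
    partials s (fun y => (y 0 k)%:C * phi y) =
    fun y => (y 0 k)%:C * partials s phi y + \sum_(t <- L) partials t phi y].
Proof.
move=> sp; elim: s => [|j s [L [sL aL pE]]].
  by exists [::]; split => //=; apply/funext => y; rewrite big_nil addr0.
exists ((if k == j then [:: s] else [::]) ++ map (cons j) L); split.
- by rewrite size_cat size_map/=; case: (k == j) => //=; rewrite ltnW.
- rewrite all_cat all_map; apply/andP; split; first by case: (k == j) => /=; rewrite ?leqnSn.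
  by apply: sub_all aL => t /=; rewrite ltnS.
apply/funext => y; rewrite /= pE partial_add ?partial_coord ?partial_sum//.
- rewrite big_cat big_map/= [X in X + _ = _]addrC -!addrA; congr (_ + _).
  by congr (_ + _); case: (k == j); rewrite ?big_seq1 ?big_nil ?mul1r ?mul0r.
- by apply: diffC_coord; exact: smooth_diffC.
- exact: diffC_sum.
Qed.

Lemma schwartz_partial k phi : schwartz phi -> schwartz (partial k phi).
Proof.
move=> [sp hp]; split; first by move=> s x; rewrite -partials_rcons; exact: sp.
move=> p; have [M hM] := hp p.+1; exists M => s x sp'.
rewrite -partials_rcons; apply: le_trans (hM (rcons s k) x _); last by rewrite size_rcons.
by rewrite ler_wpM2r// lecR ler_weXn2l// lerDl.
Qed.

Lemma coord_le_norm k x : `|x 0 k| <= `|x|.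
Proof.
rewrite [leRHS]/Num.norm/= mx_normrE.
by apply/bigmax_geP; right => /=; exists (0, k).
Qed.

Lemma schwartz_coord k phi : schwartz phi -> schwartz (fun x => (x 0 k)%:C * phi x).
Proof.
move=> [sp hp]; split.
  move=> s x; have [L [_ _ ->]] := partials_coord k s sp.
  apply: diffC_add; last exact: diffC_sum.
  by apply: diffC_coord; exact: smooth_diffC.
(* One [M] for the term with the coordinate, whose growth uses up one power of the weight, and one
   for each of the at most [p] commutator terms. *)
move=> p; have [M hM] := hp p.+1; exists (M + M *+ p) => s x sizes.
have [L [sL aL ->]] := partials_coord k s sp.
have w0 q : 0 <= ((1 + `|x|) ^+ q)%:C :> C by rewrite lecR exprn_ge0// addr_ge0.
have bound t : (size t <= p)%N ->
    ((1 + `|x|) ^+ p.+1)%:C * `|partials t phi x| <= M%:C.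
  by move=> tp; apply: hM; rewrite ltnW.
have M0 : 0 <= M.
  by rewrite -lecR; apply: le_trans (bound [::] isT); rewrite mulr_ge0.
apply: le_trans (ler_wpM2l (w0 p) (ler_normD _ _)) _.
rewrite mulrDr rmorphD/=; apply: lerD.
  apply: le_trans (bound s sizes); rewrite normrM mulrA ler_wpM2r//.
  rewrite cnormE cnorm_real -rmorphM/= lecR exprSr ler_wpM2l ?exprn_ge0 ?addr_ge0//.
  by rewrite (le_trans (coord_le_norm k x))// lerDr.
apply: le_trans (ler_wpM2l (w0 p) (ler_norm_sum _ _ _)) _.
rewrite mulr_sumr.
apply: (@le_trans _ _ (\sum_(t <- L) M%:C)).
  rewrite !big_seq; apply: ler_sum => t tL.
  have tp : (size t <= p)%N.
    by apply: leq_trans sizes; move/allP: aL => /(_ _ tL).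
  apply: le_trans (bound t tp); rewrite ler_wpM2r// lecR ler_weXn2l ?lerDl//.
rewrite big_const_seq count_predT iter_addr_0 -rmorphMn/= lecR.
by rewrite -!(mulr_natr M) ler_wpM2l// ler_nat (leq_trans sL).
Qed.

End Schwartz.

(** * The operator transposed to test functions *)

Section SpectralShift.
Context {R : realType}.
Variables m N d : nat.
Local Notation n := m.+1.
Local Notation C := R[i].
Variable gamma : 'I_n -> 'M[C]_N.
Implicit Types (T : functional R n N d) (phi : 'rV[R]_n -> C).

(** Transposition reverses the order in Delta(x_n T): on the test function the derivatives act first
    and the coordinate multiplies afterwards. *)
Definition laplace_test (k : 'I_n) phi : 'rV[R]_n -> C :=
  fun x => (x 0 ord_max)%:C * partial k (partial k phi) x.

Lemma spectral_shiftE l T phi : spectral_shift gamma l T phi =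
  (2 * l - n%:R - 1) *: T (partial ord_max phi)
  - \sum_k (gamma k *m gamma ord_max) *m T (partial k phi)
  + \sum_k T (laplace_test k phi).
Proof.
rewrite /spectral_shift /dist_add /dist_scale /dist_dirac /dist_laplace /dist_mul.
rewrite /dist_partial /dist_coord addrA; congr (_ + _ + _).
- rewrite scalerN -scaleNr; congr (_ *: _); ring.
- by rewrite -sumrN; apply: eq_bigr => k _; rewrite mulmxN mulmxA.
- by apply: eq_bigr => k _; rewrite opprK.
Qed.

Lemma schwartz_laplace_test k phi : schwartz phi -> schwartz (laplace_test k phi).
Proof.
by move=> ?; apply: schwartz_coord; do 2! apply: schwartz_partial.
Qed.

Lemma spectral_shift_scale l T T' (a : C) phi : schwartz phi ->
  (forall psi, schwartz psi -> T psi = a *: T' psi) ->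
  spectral_shift gamma l T phi = a *: spectral_shift gamma l T' phi.
Proof.
move=> sphi TT'; rewrite !spectral_shiftE !scalerDr scalerN !scaler_sumr.
rewrite TT' ?scalerA; last exact: schwartz_partial.
congr (_ *: _ + _ + _); first by rewrite mulrC.
- congr (- _); apply: eq_bigr => k _; rewrite TT' ?scalemxAr//.
  exact: schwartz_partial.
- by apply: eq_bigr => k _; rewrite TT'//; exact: schwartz_laplace_test.
Qed.

Lemma analytic_sum (I : Type) (s : seq I) (F : I -> C -> C -> C) l v :
  (forall i, analytic_at (F i) l v) ->
  analytic_at (fun l v => \sum_(i <- s) F i l v) l v.
Proof.
move=> aF; elim: s => [|i s ih].
  have -> : (fun l v => \sum_(i <- [::]) F i l v) = (fun _ _ => 0).
    by apply/funext => l'; apply/funext => v'; rewrite big_nil.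
  exact: analytic_cst.
have -> : (fun l v => \sum_(j <- i :: s) F j l v) =
    (fun l v => F i l v + \sum_(j <- s) F j l v).
  by apply/funext => l'; apply/funext => v'; rewrite big_cons.
exact: (analytic_add (aF i) ih).
Qed.

Lemma analytic_spectral_shift (F : C -> C -> functional R n N d) l v phi i j :
  schwartz phi ->
  (forall psi p q, schwartz psi -> analytic_at (fun l v => F l v psi p q) l v) ->
  analytic_at (fun l v => spectral_shift gamma l (F l v) phi i j) l v.
Proof.
move=> sphi aF.
have -> : (fun l v => spectral_shift gamma l (F l v) phi i j) = (fun l v =>
    (2 * l + (- n%:R - 1)) * F l v (partial ord_max phi) i j
    + (\sum_k \sum_p (- (gamma k *m gamma ord_max) i p) * F l v (partial k phi) p j
    + \sum_k F l v (laplace_test k phi) i j)).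
  apply/funext => l'; apply/funext => v'; rewrite spectral_shiftE !mxE !summxE -addrA.
  congr (_ * _ + (_ + _)); first by rewrite !addrA.
  by rewrite -sumrN; apply: eq_bigr => k _; rewrite mxE -sumrN; apply: eq_bigr => p _;
    rewrite mulNr.
apply: analytic_add.
  apply: analytic_mul; last by apply: aF; exact: schwartz_partial.
  apply: analytic_add; last exact: analytic_cst.
  apply: analytic_mul; [exact: analytic_cst|exact: analytic_fst].
apply: analytic_add; apply: analytic_sum => k.
  apply: analytic_sum => p; apply: analytic_mul; first exact: analytic_cst.
  by apply: aF; exact: schwartz_partial.
by apply: aF; exact: schwartz_laplace_test.
Qed.

(** Supplies the local data of [continuation]. The common denominator is [g1 l v * g2 (l - 1) v],
    where [g2] comes from the representation of [T] around the shifted centre [(l0 - 1, v0)]. *)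
Lemma spectral_shift_local (S T : C -> C -> functional R n N d)
    (c : C -> C -> C) :
  meromorphic_family S -> meromorphic_family T ->
  (forall l v, analytic_at c l v) ->
  forall l0 v0, exists r g (F : C -> C -> functional R n N d),
    [/\ 0 < r, denominator (polydisc l0 v0 r) g,
        (forall phi i j, schwartz phi ->
           holomorphic_in (polydisc l0 v0 r) (fun l v => F l v phi i j)) &
        forall l v, polydisc l0 v0 r l v -> g l v != 0 ->
          forall phi, schwartz phi ->
            F l v phi = g l v *: (spectral_shift gamma l (S l v) phi
                                  - dist_scale (c l v) (T (l - 1) v) phi)].
Proof.
move=> mS mT ac l0 v0.
have [r1 [g1 [F1 [r10 dg1 [_ hF1] SE]]]] := mS l0 v0.
have [r2 [g2 [F2 [r20 dg2 [_ hF2] TE]]]] := mT (l0 - 1) v0.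
pose r := Num.min r1 r2; have r0 : 0 < r by rewrite lt_min r10.
have sub1 l v : polydisc l0 v0 r l v -> polydisc l0 v0 r1 l v.
  by apply: polydisc_le; rewrite ge_min lexx.
have sub2 l v : polydisc l0 v0 r l v -> polydisc (l0 - 1) v0 r2 (l - 1) v.
  move=> D; apply/polydisc_shift; apply: polydisc_le D.
  by rewrite ge_min lexx orbT.
have dg2' : denominator (polydisc l0 v0 r2) (fun l v => g2 (l - 1) v).
  have [hg2 [l [v [D gn0]]]] := dg2; split.
    by move=> l' v' D'; apply: analytic_shift; apply: hg2; exact/polydisc_shift.
  exists (l + 1), v; rewrite addrK; split => //.
  by apply/(polydisc_shift _ _ (-1)); rewrite addrK.
have {}dg1 := denominator_sub dg1 (polydisc_center _ _ r10) r0 sub1.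
have {}dg2' : denominator (polydisc l0 v0 r) (fun l v => g2 (l - 1) v).
  apply: denominator_sub dg2' (polydisc_center _ _ r20) r0 _ => l v.
  by apply: polydisc_le; rewrite ge_min lexx orbT.
exists r, (fun l v => g1 l v * g2 (l - 1) v).
exists (fun l v phi => g2 (l - 1) v *: spectral_shift gamma l (F1 l v) phi
  - (g1 l v * c l v) *: F2 (l - 1) v phi).
split => //; first exact: denominator_mul.
- move=> phi i j sphi l v D.
  have -> : (fun l v => (g2 (l - 1) v *: spectral_shift gamma l (F1 l v) phi
      - (g1 l v * c l v) *: F2 (l - 1) v phi) i j) =
    (fun l v => g2 (l - 1) v * spectral_shift gamma l (F1 l v) phi i j
      + (-1) * (g1 l v * c l v) * F2 (l - 1) v phi i j).
    by apply/funext => l'; apply/funext => v'; rewrite !mxE mulN1r mulNr.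
  apply: analytic_add; apply: analytic_mul.
  + exact: (proj1 dg2').
  + apply: analytic_spectral_shift => // psi p q spsi.
    by apply: hF1 => //; exact: sub1.
  + apply: analytic_mul; first exact: analytic_cst.
    by apply: analytic_mul => //; exact: (proj1 dg1).
  + apply: (@analytic_shift _ (fun l v => F2 l v phi i j)).
    by apply: hF2 => //; exact: sub2.
- move=> l v D; rewrite mulf_eq0 negb_or => /andP[g1n0 g2n0] phi sphi.
  rewrite (spectral_shift_scale _ sphi (SE _ _ (sub1 _ _ D) g1n0)).
  rewrite /dist_scale (TE _ _ (sub2 _ _ D) g2n0 _ sphi) scalerBr !scalerA.
  congr (_ *: _ - _ *: _).
    by rewrite mulrAC divff// mul1r.
  by field.
Qed.

End SpectralShift.

(** * Integration over R^n *)

Section RealLine.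
Context {R : realType}.
Local Notation mu := (@lebesgue_measure R).

Lemma integrable_oneDsqrV : mu.-integrable setT (fun x : R => (oneDsqr x)^-1%:E).
Proof.
have h0 (x : R) : 0 <= (oneDsqr x)^-1 by rewrite invr_ge0.
apply/integrableP; split.
  by apply/measurable_EFinP; apply: continuous_measurable_fun; exact: continuous_oneDsqrV.
under eq_integral => x _ do rewrite gee0_abs ?lee_fin//.
rewrite ge0_symfun_integralT//.
- have -> : [set x : R | (0 <= x)%R] = `[0%R, +oo[%classic.
    by apply/seteqP; split => x /=; rewrite in_itv/= andbT.
  by rewrite integral0y_oneDsqr ltry.
- exact: continuous_oneDsqrV.
- by move=> x; rewrite /= /oneDsqr sqrrN.
Qed.

(** The fundamental theorem on growing symmetric intervals: dominated convergence handles the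
    integrals, and the decay of [G] makes the boundary values tend to 0. *)
Lemma integral_derive_eq0 (g G : R -> R) (M : R) :
  continuous g -> mu.-integrable setT (EFin \o g) ->
  (forall x : R, is_derive x 1 G (g x)) -> (forall x, `|G x| <= M / oneDsqr x) ->
  (\int[mu]_x (g x)%:E = 0)%E.
Proof.
move=> cg ig dG GM.
pose I (k : nat) := `[(- k.+1%:R : R), k.+1%:R]%classic.
have E k : (\int[mu]_(x in I k) (g x)%:E = (G k.+1%:R - G (- k.+1%:R))%:E)%E.
  rewrite (@continuous_FTC2 _ g G)// ?gtrN//.
  - exact: continuous_subspaceT.
  - split.
    + by move=> x _; have := dG x; move/@ex_derive.
    + apply: cvg_at_right_filter; have := dG (- k.+1%:R); move/@ex_derive.
      by move/derivable1_diffP/differentiable_continuous.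
    + apply: cvg_at_left_filter; have := dG (k.+1%:R); move/@ex_derive.
      by move/derivable1_diffP/differentiable_continuous.
  - by move=> x _; rewrite derive1E; have := dG x; move/@derive_val.
have [] := @dominated_convergence _ _ R mu setT measurableT
  (fun k => (EFin \o g) \_ (I k)) (EFin \o g) (abse \o EFin \o g).
- move=> k; apply: (measurable_restrictT _ _).1; first exact: measurable_itv.
  apply: measurable_funTS; apply/measurable_EFinP; exact: continuous_measurable_fun.
- by apply/measurable_EFinP; exact: continuous_measurable_fun.
- apply: aeW => x _; apply: cvg_near_cst.
  exists (Num.truncn `|x|) => // k /= xk; rewrite patchE mem_set//=.
  rewrite /I/= in_itv/= -ler_norml (le_trans (ltW (truncnS_gt _)))//.
  by rewrite ler_nat ltnS.
- exact: integrable_abse.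
- apply: aeW => x k _; rewrite patchE; case: ifPn => //= _.
  by rewrite normr0 lee_fin.
move=> _ _ /=.
under eq_fun do rewrite -integral_mkcond E.
move=> cv; apply: (cvg_unique (@ereal_hausdorff R) cv).
apply: cvg_EFin; first exact: nearW.
have cG (s : nat -> R) : (forall k, `|s k| = k.+1%:R) -> (G \o s) @ \oo --> 0.
  move=> sE; apply/norm_cvg0P.
  have : `|M| / k.+1%:R @[k --> \oo] --> `|M| * 0.
    by apply: cvgM; [exact: cvg_cst|exact: cvg_harmonic].
  rewrite mulr0; apply: (@squeeze_cvgr _ _ _ _ (fun _ => 0)); last exact: cvg_cst.
  apply: nearW => k /=; rewrite normr_ge0/=.
  apply: le_trans (GM _) _; apply: (@le_trans _ _ (`|M| / oneDsqr (s k))).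
    by rewrite ler_wpM2r ?invr_ge0// ler_norm.
  rewrite ler_wpM2l// lef_pV2 ?posrE//.
  rewrite /oneDsqr -real_normK ?num_real// sE; have : 1 <= k.+1%:R :> R by rewrite ler1n.
  by move=> k1; nra.
rewrite -(subr0 0); apply: cvgB.
  by apply: cG => k; rewrite normr_nat.
by apply: cG => k; rewrite normrN normr_nat.
Qed.

(* [f] is the pointwise limit of [f (floor (k x) / k, t)]. *)
Lemma measurable_caratheodory d (T : measurableType d) (f : R * T -> R) :
  (forall t, continuous (fun x => f (x, t))) ->
  (forall x, measurable_fun setT (fun t => f (x, t))) ->
  measurable_fun setT f.
Proof.
move=> cf mf.
pose u (k : nat) (x : R) : R := (Num.floor (x * k.+1%:R))%:~R / k.+1%:R.
apply: (measurable_fun_cvg (h := fun k z => f (u k z.1, z.2))).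
  move=> k _ B mB; rewrite setTI.
  pose A (z : int) : set (R * T) :=
    [set x : R | Num.floor (x * k.+1%:R) = z] `*`
    ((fun t => f (z%:~R / k.+1%:R, t)) @^-1` B).
  have mA z : measurable (A z).
    apply: measurableX; last first.
      by rewrite -[X in measurable X]setTI; exact: mf.
    have -> : [set x : R | Num.floor (x * k.+1%:R) = z] =
        (fun x => x * k.+1%:R) @^-1` `[z%:~R, (z + 1)%:~R[%classic.
      apply/seteqP; split => x /=.
        by move=> xz; rewrite in_itv/= -floor_eq xz.
      by rewrite in_itv/= -floor_eq => /eqP.
    rewrite -[X in measurable X]setTI.
    have m : measurable_fun setT (fun x : R => x * k.+1%:R) by exact: mulrr_measurable.
    by apply: m => //; exact: measurable_itv.
  (* The floor takes countably many values, so the preimage is a union of rectangles indexed by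
     integers, here enumerated through [unpickle]. *)
  have -> : (fun z : R * T => f (u k z.1, z.2)) @^-1` B =
      \bigcup_i (if @unpickle int i is Some z then A z else set0).
    apply/seteqP; split => [[x t] /= Bxt|[x t] [i _]].
      exists (pickle (Num.floor (x * k.+1%:R))); first exact: Logic.I.
      by rewrite pickleK; split.
    case: unpickle => //= z [/= xz Bt].
    by rewrite /= /u xz.
  by apply: bigcupT_measurable => i; case: unpickle.
move=> [x t] _ /=; suff cu : u k x @[k --> \oo] --> x.
  exact: (cvg_comp _ _ cu (cf t x)).
apply/cvgrPdist_le => e e0; near=> k.
rewrite /u; have /andP[h1 h2] := floor_itv (x * k.+1%:R).
rewrite -[x in `|x - _|](mulfK (_ : k.+1%:R != 0)) ?pnatr_eq0// -mulrBl normrM.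
rewrite (ger0_norm (_ : 0 <= _ - _)) ?subr_ge0// ger0_norm//.
rewrite ler_pdivrMr//.
apply: (@le_trans _ _ 1).
  by rewrite lerBlDr addrC -[1]/(1%:~R) -intrD ltW.
rewrite -ler_pdivrMl// mulr1.
near: k; exists (Num.truncn e^-1) => // k /= ek.
by rewrite (le_trans (ltW (truncnS_gt _)))// ler_nat ltnS.
Unshelve. all: by end_near. Qed.

End RealLine.

(** * Fubini arguments for the product Lebesgue measure *)

Section TupleMeasure.
Context {R : realType}.
Local Notation leb := (@lebesgue_measure R).

Definition upd n (t : n.-tuple R) (k : 'I_n) (y : R) : n.-tuple R :=
  [tuple if i == k then y else tnth t i | i < n].

Lemma upd_cons0 n (t : n.-tuple R) x y :
  upd (tuple_cons (x, t)) ord0 y = tuple_cons (y, t).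
Proof.
apply: eq_from_tnth => i; rewrite tnth_mktuple.
have [->|] := eqVneq i ord0; first by rewrite /tuple_cons/= tnth0.
by case: (unliftP ord0 i) => [j -> _|->//]; rewrite !tnthS.
Qed.

Lemma upd_consS n (t : n.-tuple R) (k : 'I_n) x y :
  upd (tuple_cons (x, t)) (lift ord0 k) y = tuple_cons (x, upd t k y).
Proof.
apply: eq_from_tnth => i; rewrite tnth_mktuple.
case: (unliftP ord0 i) => [j ->|->].
  by rewrite !tnthS tnth_mktuple (inj_eq lift_inj).
by rewrite (negbTE (neq_lift _ _)) !tnth0.
Qed.

(** Stated through one-coordinate updates, it passes to slices. By [measurable_caratheodory],
    applied one coordinate at a time, it implies measurability for the product sigma-algebra. *)
Definition separately_continuous n (f : n.-tuple R -> R) : Prop :=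
  forall k t, continuous (fun x => f (upd t k x)).

Lemma separately_continuous_slice n (f : n.+1.-tuple R -> R) x :
  separately_continuous f -> separately_continuous (fun t => f (tuple_cons (x, t))).
Proof.
move=> cf k t y; have := cf (lift ord0 k) (tuple_cons (x, t)) y.
by under eq_fun do rewrite upd_consS; exact.
Qed.

Lemma separately_continuous0 n (f : n.+1.-tuple R -> R) :
  separately_continuous f -> forall t, continuous (fun x => f (tuple_cons (x, t))).
Proof.
move=> cf t x; have := cf ord0 (tuple_cons (x, t)) x.
by under eq_fun do rewrite upd_cons0; exact.
Qed.

Lemma separately_continuous_measurable n (f : n.-tuple R -> R) :
  separately_continuous f -> measurable_fun setT f.
Proof.
elim: n f => [|n ih] f cf.
  have -> : f = cst (f [tuple]) by apply/funext => t; rewrite tuple0.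
  exact: measurable_cst.
have -> : f = (fun z => f (tuple_cons z)) \o @tuple_uncons R n.
  by apply/funext => t /=; rewrite tuple_unconsK.
apply: measurableT_comp; last exact: measurable_tuple_uncons.
apply: measurable_caratheodory => [t|x].
  exact: separately_continuous0.
by apply: ih; exact: separately_continuous_slice.
Qed.

Lemma ge0_integral_RnS n (f : n.+1.-tuple R -> \bar R) :
  measurable_fun setT f -> (forall t, (0 <= f t)%E) ->
  (\int[lebesgue_Rn n.+1]_t f t =
   \int[leb \x lebesgue_Rn n]_z f (tuple_cons z))%E.
Proof.
move=> mf f0; transitivity
  (\int[pushforward (leb \x lebesgue_Rn n)%E (@tuple_cons R n)]_t f t)%E.
  by apply: eq_measure_integral => //; exact: measurable_tuple_cons.
by apply: ge0_integral_pushforward => //; exact: measurable_tuple_cons.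
Qed.

Lemma integral_RnS n (f : n.+1.-tuple R -> \bar R) :
  measurable_fun setT f ->
  (leb \x lebesgue_Rn n)%E.-integrable setT (fun z => f (tuple_cons z)) ->
  (\int[lebesgue_Rn n.+1]_t f t =
   \int[leb \x lebesgue_Rn n]_z f (tuple_cons z))%E.
Proof.
move=> mf intf; transitivity
  (\int[pushforward (leb \x lebesgue_Rn n)%E (@tuple_cons R n)]_t f t)%E.
  by apply: eq_measure_integral => //; exact: measurable_tuple_cons.
by apply: integral_pushforward => //; exact: measurable_tuple_cons.
Qed.

(** The integrable majorant behind every absolute convergence below. As a product over coordinates
    it splits under [tuple_cons], which suits induction on the dimension. *)
Definition weight n (t : n.-tuple R) : R := \prod_(i < n) (oneDsqr (tnth t i))^-1.

Lemma weight_ge0 n (t : n.-tuple R) : 0 <= weight t.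
Proof. by apply: prodr_ge0 => i _; rewrite invr_ge0. Qed.

Lemma weight_cons n x (t : n.-tuple R) :
  weight (tuple_cons (x, t)) = (oneDsqr x)^-1 * weight t.
Proof.
rewrite /weight big_ord_recl tnth0; congr (_ * _).
by apply: eq_bigr => i _; rewrite tnthS.
Qed.

Lemma measurable_weight n : measurable_fun setT (@weight n).
Proof.
apply: measurable_prod => i _; have mi := @measurable_tnth _ R n i.
have mo : measurable_fun setT (fun x : R => (oneDsqr x)^-1).
  by apply: continuous_measurable_fun; exact: continuous_oneDsqrV.
exact: measurableT_comp mo mi.
Qed.

Lemma measurable_EFin_weight n :
  measurable_fun setT (fun t : n.-tuple R => (weight t)%:E).
Proof. exact: measurableT_comp (@EFin_measurable R setT) (@measurable_weight n). Qed.

Lemma integral_weight n :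
  (\int[lebesgue_Rn n]_t (weight t)%:E < +oo)%E.
Proof.
elim: n => [|n ih].
  rewrite /= integral_dirac//; last exact: measurable_EFin_weight.
  by rewrite diracT mul1e ltry.
rewrite ge0_integral_RnS; [|exact: measurable_EFin_weight|by move=> t; rewrite lee_fin weight_ge0].
rewrite fubini_tonelli1; last 2 first.
- apply: (measurableT_comp (@measurable_EFin_weight n.+1)).
  exact: measurable_tuple_cons.
- by move=> z; rewrite lee_fin weight_ge0.
have hZ x : (\int[lebesgue_Rn n]_t (weight (tuple_cons (x, t)))%:E =
    (oneDsqr x)^-1%:E * \int[lebesgue_Rn n]_t (weight t)%:E)%E.
  under eq_integral => t _ do rewrite weight_cons EFinM.
  rewrite ge0_integralZl//; first exact: measurable_EFin_weight.
  by move=> t _; rewrite lee_fin weight_ge0.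
rewrite /fubini_F; under eq_integral => x _ do rewrite hZ.
have w0 : (0 <= \int[lebesgue_Rn n]_t (weight t)%:E)%E.
  by apply: integral_ge0 => t _; rewrite lee_fin weight_ge0.
have fin : (\int[lebesgue_Rn n]_t (weight t)%:E \is a fin_num)%E by rewrite ge0_fin_numE.
rewrite -(fineK fin) ge0_integralZr//; last 2 first.
- exact: (measurableT_comp (@EFin_measurable R setT)
    (continuous_measurable_fun (@continuous_oneDsqrV R))).
- by rewrite lee_fin fine_ge0.
rewrite lte_mul_pinfty//.
- by apply: integral_ge0 => x _; rewrite lee_fin invr_ge0.
- rewrite ge0_fin_numE; last by apply: integral_ge0 => x _; rewrite lee_fin invr_ge0.
  have /integrableP[_] := @integrable_oneDsqrV R.
  congr (_ < _)%E; apply: eq_integral => x _.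
  by rewrite gee0_abs// lee_fin invr_ge0.
- by rewrite ltry.
Qed.

Lemma integrable_weight n (f : n.-tuple R -> R) (M : R) :
  measurable_fun setT f -> (forall t, `|f t| <= M * weight t) ->
  (lebesgue_Rn n).-integrable setT (EFin \o f).
Proof.
move=> mf fM; apply: (@le_integrable _ _ _ _ _ measurableT _ (fun t => (`|M| * weight t)%:E)) => //.
- exact/measurable_EFinP.
- move=> t _ /=; rewrite lee_fin (le_trans (fM t))// ger0_norm.
    by rewrite ler_wpM2r ?weight_ge0// ler_norm.
  by rewrite mulr_ge0// weight_ge0.
- under eq_fun do rewrite EFinM.
  apply: integrableZl => //; apply/integrableP; split.
    exact: measurable_EFin_weight.
  under eq_integral => x _ do rewrite gee0_abs ?lee_fin ?weight_ge0//.
  exact: integral_weight.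
Qed.

Lemma integrable_weight_prod n (f : n.+1.-tuple R -> R) (M : R) :
  measurable_fun setT f -> (forall t, `|f t| <= M * weight t) ->
  (leb \x lebesgue_Rn n)%E.-integrable setT (fun z => (f (tuple_cons z))%:E).
Proof.
move=> mf fM; apply/integrableP; split.
  apply/measurable_EFinP; apply: (measurableT_comp mf); exact: measurable_tuple_cons.
have /integrableP[_] := integrable_weight mf fM.
rewrite ge0_integral_RnS//.
apply: measurableT_comp => //; exact/measurable_EFinP.
Qed.

(** Fubini brings the differentiated coordinate inside. The weight bounds give integrability on
    slices and the decay of [G] there. *)
Lemma integral_partial_eq0 n (k : 'I_n) (g G : n.-tuple R -> R) (M : R) :
  separately_continuous g -> (forall t, `|g t| <= M * weight t) ->
  (forall t (x : R), is_derive x 1 (fun y => G (upd t k y)) (g (upd t k x))) ->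
  (forall t, `|G t| <= M * weight t) ->
  (\int[lebesgue_Rn n]_t (g t)%:E = 0)%E.
Proof.
elim: n k g G M => [[]//|n ih] k g G M cg gM dG GM.
have mg := separately_continuous_measurable cg.
have ig := integrable_weight_prod mg gM.
rewrite integral_RnS//; last exact/measurable_EFinP.
have [j kE|kE] := unliftP ord0 k.
  (* The direction lies in the tail: for fixed first coordinate [x] the inner integral vanishes by
     induction, with bound [M / oneDsqr x]. *)
  rewrite -integral12_prod_meas1//.
  apply: integral0_eq => x _; rewrite /fubini_F.
  apply: (ih j (fun t => g (tuple_cons (x, t))) (fun t => G (tuple_cons (x, t)))
    (M / oneDsqr x)).
  - exact: separately_continuous_slice.
  - by move=> t; rewrite -mulrA -weight_cons.
  - move=> t y; have := dG (tuple_cons (x, t)) y; rewrite kE upd_consS.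
    by under eq_fun do rewrite upd_consS.
  - by move=> t; rewrite -mulrA -weight_cons.
(* The direction is the first coordinate: it is integrated innermost, by the one-dimensional
   lemma. *)
rewrite -integral21_prod_meas1//.
apply: integral0_eq => t _; rewrite /fubini_G.
have bnd (f : n.+1.-tuple R -> R) : (forall t, `|f t| <= M * weight t) ->
    forall x, `|f (tuple_cons (x, t))| <= M * weight t / oneDsqr x.
  by move=> fM x; apply: le_trans (fM _) _; rewrite weight_cons mulrCA mulrC.
have cg0 : continuous (fun x => g (tuple_cons (x, t))).
  exact: separately_continuous0.
apply: (@integral_derive_eq0 _ (fun x => g (tuple_cons (x, t)))
    (fun x => G (tuple_cons (x, t))) (M * weight t)) => //.
- apply: (@le_integrable _ _ _ leb setT measurableT _ (fun x => (`|M * weight t| * (oneDsqr x)^-1)%:E)) => //.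
  + by apply/measurable_EFinP; exact: continuous_measurable_fun.
  + move=> x _ /=; rewrite lee_fin (le_trans (bnd _ gM x))// ger0_norm.
      by rewrite ler_wpM2r ?invr_ge0// ler_norm.
    by rewrite mulr_ge0// invr_ge0.
  + under eq_fun do rewrite EFinM.
    by apply: integrableZl => //; exact: integrable_oneDsqrV.
- move=> x; have := dG (tuple_cons (x, t)) x; rewrite kE upd_cons0.
  by under eq_fun do rewrite upd_cons0.
- exact: bnd.
Qed.

Lemma lebesgue_Rn_hyperplane n (k : 'I_n) :
  lebesgue_Rn n [set t | tnth t k = 0 :> R] = 0%E.
Proof.
elim: n k => [|n ih] k; first by case: k.
rewrite /= /lebesgue_step; case: (unliftP ord0 k) => [j|] ->.
  have -> : @tuple_cons R n @^-1` [set t | tnth t (lift ord0 j) = 0] =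
      setT `*` [set t | tnth t j = 0].
    by apply/seteqP; split => -[x t] /=; rewrite tnthS => //; case.
  rewrite product_measure1E ?ih ?mule0//.
  have := @measurable_tnth _ R n j measurableT [set 0] (measurable_set1 0).
  by rewrite setTI.
have -> : @tuple_cons R n @^-1` [set t | tnth t ord0 = 0] = [set 0] `*` setT.
  by apply/seteqP; split => -[x t] /=; rewrite tnth0 => //; case.
rewrite product_measure1E// [X in (X * _)%E](_ : _ = 0%E) ?mul0e//.
exact: lebesgue_measure_set1.
Qed.

(** The hyperplane is null, but the almost-everywhere comparison also asks that [f] be measurable.
    Prescribing its values on the hyperplane by a measurable [h] ensures this. *)
Lemma Rintegral_off_hyperplane n (k : 'I_n) (f g h : n.-tuple R -> R) :
  measurable_fun setT g -> measurable_fun setT h ->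
  (forall t, f t = if tnth t k == 0 then h t else g t) ->
  Rintegral (lebesgue_Rn n) setT f = Rintegral (lebesgue_Rn n) setT g.
Proof.
move=> mg mh fE.
have mH : measurable [set t : n.-tuple R | tnth t k = 0].
  have := @measurable_tnth _ R n k measurableT [set 0] (measurable_set1 0).
  by rewrite setTI.
have mf : measurable_fun setT f.
  have -> : f = fun t => if tnth t k == 0 then h t else g t by apply/funext.
  apply: measurable_fun_ifT => //; apply: measurable_fun_eqr => //.
  exact: measurable_tnth.
congr fine; apply: ae_eq_integral => //; [exact/measurable_EFinP|exact/measurable_EFinP|].
exists [set t | tnth t k = 0]; split => //; first exact: lebesgue_Rn_hyperplane.
move=> t /=; apply: contra_notP => /eqP tk _.
by rewrite /= fE (negbTE tk).
Qed.

End TupleMeasure.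

(** * Pairing functions of polynomial growth with Schwartz functions *)

Section ComplexIntegral.
Context {R : realType}.
Variable n : nat.
Local Notation C := R[i].
Local Notation Rn := 'rV[R]_n.
Implicit Types (f : Rn -> R) (g h phi : Rn -> C) (x : Rn).

Definition rowt (t : n.-tuple R) : Rn := \row_k tnth t k.

Lemma rowt_upd (t : n.-tuple R) (k : 'I_n) (y h : R) :
  rowt (upd t k (h + y)) = h *: delta_mx 0 k + rowt (upd t k y).
Proof.
apply/rowP => i; rewrite !mxE !tnth_mktuple eqxx /=.
by case: eqP => _; rewrite ?mulr1 ?mulr0 ?add0r.
Qed.

(** Moving one entry of the tuple is a translation along [delta_mx 0 k], so the two difference
    quotients are the same function of [h]. *)
Lemma is_derive_upd f (df : R) t k (y : R) :
  is_derive (rowt (upd t k y)) (delta_mx 0 k) f df ->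
  is_derive y 1 (fun z => f (rowt (upd t k z))) df.
Proof.
move=> [d1 d2].
have E : (fun h : R => h^-1 *: (((fun z => f (rowt (upd t k z))) \o shift y) (h *: 1)
      - f (rowt (upd t k y)))) =
    (fun h : R => h^-1 *: ((f \o shift (rowt (upd t k y))) (h *: delta_mx 0 k)
      - f (rowt (upd t k y)))).
  by apply/funext => h /=; rewrite [h%:A]mulr1 rowt_upd.
apply: DeriveDef; first by rewrite /derivable E.
by rewrite /derive E.
Qed.

Lemma continuous_separately f :
  continuous f -> separately_continuous (f \o rowt).
Proof.
move=> cf k t y /=.
have cr : {for y, continuous (fun z => rowt (upd t k z))}.
  have -> : (fun z => rowt (upd t k z)) =
      (fun z => (z - y) *: delta_mx 0 k + rowt (upd t k y)).
    by apply/funext => z; rewrite -rowt_upd subrK.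
  apply: cvgD; last exact: cvg_cst.
  apply: cvgZr_tmp; apply: cvgB; [exact: cvg_id|exact: cvg_cst].
exact: continuous_comp cr (cf _).
Qed.

Definition polybounded f : Prop :=
  exists (p : nat) (A : R), forall x, `|f x| <= A * (1 + `|x|) ^+ p.

(** An algebra of functions whose products with a rapidly decreasing function are dominated by
    [weight]. Every derivative of the kernel that occurs below stays in it. *)
Definition nice f : Prop := continuous f /\ polybounded f.

Lemma norm1_ge1 x : 1 <= 1 + `|x|. Proof. by rewrite lerDl. Qed.

Lemma polybounded_ge0 f : polybounded f ->
  exists (p : nat) (A : R), 0 <= A /\ forall x, `|f x| <= A * (1 + `|x|) ^+ p.
Proof.
move=> [p [A h]]; exists p, `|A|; split => // x; apply: le_trans (h x) _.
by rewrite ler_wpM2r ?exprn_ge0 ?addr_ge0// ler_norm.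
Qed.

Lemma nice_cst c : nice (fun=> c).
Proof.
split; first exact: cst_continuous.
by exists 0, `|c| => x; rewrite expr0 mulr1.
Qed.

Lemma nice_coord k : nice (fun x => x 0 k).
Proof.
split; first exact: coord_continuous.
exists 1, 1 => x; rewrite mul1r expr1 (le_trans (coord_le_norm k x))//.
by rewrite lerDr.
Qed.

Lemma niceD f f' : nice f -> nice f' -> nice (fun x => f x + f' x).
Proof.
move=> [cf /polybounded_ge0[p [A [A0 fA]]]] [cf' /polybounded_ge0[q [B [B0 fB]]]].
split; first by move=> x; exact: (continuousD (cf x) (cf' x)).
exists (maxn p q), (A + B) => x; rewrite (le_trans (ler_normD _ _))// mulrDl.
apply: lerD; [apply: le_trans (fA x) _|apply: le_trans (fB x) _];
  by rewrite ler_wpM2l// ler_weXn2l ?norm1_ge1// ?leq_maxl ?leq_maxr.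
Qed.

Lemma niceM f f' : nice f -> nice f' -> nice (fun x => f x * f' x).
Proof.
move=> [cf /polybounded_ge0[p [A [A0 fA]]]] [cf' /polybounded_ge0[q [B [B0 fB]]]].
split; first by move=> x; exact: (continuousM (cf x) (cf' x)).
exists (p + q)%N, (A * B) => x; rewrite normrM exprD mulrACA.
by apply: ler_pM.
Qed.

Lemma nice_sum (I : Type) (s : seq I) (F : I -> Rn -> R) :
  (forall i, nice (F i)) -> nice (fun x => \sum_(i <- s) F i x).
Proof.
move=> nF; elim: s => [|i s ih].
  by under eq_fun do rewrite big_nil; exact: nice_cst.
by under eq_fun do rewrite big_cons; exact: niceD.
Qed.

Lemma niceX f k : nice f -> nice (fun x => f x ^+ k).
Proof.
move=> nf; elim: k => [|k ih].
  by under eq_fun do rewrite expr0; exact: nice_cst.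
by under eq_fun do rewrite exprS; exact: niceM.
Qed.

Definition rapid f : Prop := continuous f /\
  forall p : nat, exists M : R, forall x, (1 + `|x|) ^+ p * `|f x| <= M.

(** In each coordinate 1 + t_i^2 <= (1 + |t|)^2, so [2 * n] further powers of decay pay for the
    weight. *)
Lemma weight_norm (t : n.-tuple R) :
  1 <= (1 + `|rowt t|) ^+ (2 * n) * weight t.
Proof.
have -> : (1 + `|rowt t|) ^+ (2 * n) = \prod_(i < n) (1 + `|rowt t|) ^+ 2.
  by rewrite prodr_const card_ord exprM.
rewrite /weight -big_split/=.
have {1}-> : (1 : R) = \prod_(i < n) 1 by rewrite big1.
apply: ler_prod => i _; rewrite ler01/= ler_pdivlMr// mul1r.
have := coord_le_norm i (rowt t); rewrite mxE => h.
rewrite /oneDsqr -real_normK ?num_real//.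
have := normr_ge0 (rowt t); have := normr_ge0 (tnth t i); nra.
Qed.

Lemma nice_rapid f psi : nice f -> rapid psi ->
  exists M, forall t, `|f (rowt t) * psi (rowt t)| <= M * weight t.
Proof.
move=> [_ /polybounded_ge0[p [A [A0 fA]]]] [_ hpsi].
have [M hM] := hpsi (p + 2 * n)%N; exists (A * M) => t.
have w0 := weight_ge0 t; set x := rowt t.
have e0 k : 0 <= (1 + `|x|) ^+ k by rewrite exprn_ge0// addr_ge0.
rewrite normrM (le_trans (ler_wpM2r _ (fA x)))//.
rewrite -!mulrA ler_wpM2l//.
apply: (@le_trans _ _ (((1 + `|x|) ^+ (p + 2 * n) * `|psi x|) * weight t)).
  rewrite exprD -!mulrA ler_wpM2l// mulrCA ler_peMr//.
  exact: weight_norm.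
by rewrite ler_wpM2r.
Qed.

Lemma measurable_continuous f : continuous f -> measurable_fun setT (f \o rowt).
Proof.
move=> cf; apply: separately_continuous_measurable.
exact: continuous_separately.
Qed.

Lemma integrable_nice_rapid f psi : nice f -> rapid psi ->
  (lebesgue_Rn n).-integrable setT (EFin \o (fun t => f (rowt t) * psi (rowt t))).
Proof.
move=> nf rpsi; have [M hM] := nice_rapid nf rpsi.
apply: integrable_weight hM; apply: (@measurable_continuous (fun x => f x * psi x)).
by move=> x; exact: (continuousM (proj1 nf x) (proj1 rpsi x)).
Qed.

Lemma integral_by_parts_Rn (k : 'I_n) f f' psi psi' :
  nice f -> nice f' -> rapid psi -> rapid psi' ->
  (forall x, is_derive x (delta_mx 0 k) f (f' x)) ->
  (forall x, is_derive x (delta_mx 0 k) psi (psi' x)) ->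
  Rintegral (lebesgue_Rn n) setT (fun t => f (rowt t) * psi' (rowt t)) =
  - Rintegral (lebesgue_Rn n) setT (fun t => f' (rowt t) * psi (rowt t)).
Proof.
move=> nf nf' rp rp' df dp.
have [M1 h1] := nice_rapid nf rp'; have [M2 h2] := nice_rapid nf' rp.
have [M3 h3] := nice_rapid nf rp.
have i1 := integrable_nice_rapid nf rp'; have i2 := integrable_nice_rapid nf' rp.
apply/eqP; rewrite -addr_eq0 -RintegralD//; apply/eqP.
(* A single constant for the two halves of the derivative of [f * psi] and for [f * psi] itself,
   whose decay removes the boundary terms. *)
pose M := `|M1| + `|M2| + `|M3|.
rewrite /Rintegral; apply: (congr1 fine (y := 0%E)).
apply: (@integral_partial_eq0 R n k _ (fun t => f (rowt t) * psi (rowt t)) M).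
- apply: (@continuous_separately (fun x => f x * psi' x + f' x * psi x)) => x.
  exact: (continuousD (continuousM (proj1 nf x) (proj1 rp' x))
    (continuousM (proj1 nf' x) (proj1 rp x))).
- move=> t; rewrite (le_trans (ler_normD _ _))// (le_trans (lerD (h1 t) (h2 t)))//.
  rewrite -mulrDl ler_wpM2r ?weight_ge0// /M.
  have := ler_norm M1; have := ler_norm M2; have := normr_ge0 M3; lra.
- move=> t x; have := is_deriveM (is_derive_upd (df _)) (is_derive_upd (dp _)).
  by move=> /(_ t t x) d; apply: (is_derive_eq d); rewrite [X in _ + X]mulrC.
- move=> t; apply: le_trans (h3 t) _; rewrite ler_wpM2r ?weight_ge0// /M.
  have := ler_norm M3; have := normr_ge0 M1; have := normr_ge0 M2; lra.
Qed.

Lemma schwartz_rapid phi : schwartz phi ->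
  rapid (fun x => complex.Re (phi x)) /\ rapid (fun x => complex.Im (phi x)).
Proof.
move=> [sp hp].
have bnd (z : C) : `|complex.Re z| <= cnorm z /\ `|complex.Im z| <= cnorm z.
  case: z => a b; rewrite /Normc.normc/=.
  by split; rewrite -sqrtr_sqr ler_wsqrtr// ?lerDl ?lerDr sqr_ge0.
split; split.
- by move=> x; have [h _] := sp [::] x; exact: differentiable_continuous.
- move=> p; have [M hM] := hp p; exists M => x; have := hM [::] x isT.
  rewrite cnormE -rmorphM/= lecR; apply: le_trans.
  by rewrite ler_wpM2l ?exprn_ge0 ?addr_ge0//; exact: (bnd _).1.
- by move=> x; have [_ h] := sp [::] x; exact: differentiable_continuous.
- move=> p; have [M hM] := hp p; exists M => x; have := hM [::] x isT.
  rewrite cnormE -rmorphM/= lecR; apply: le_trans.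
  by rewrite ler_wpM2l ?exprn_ge0 ?addr_ge0//; exact: (bnd _).2.
Qed.

Definition pairing f phi : C := integral_Rn (fun x => (f x)%:C * phi x).

Lemma pairingE f phi : pairing f phi =
  Rintegral (lebesgue_Rn n) setT (fun t => f (rowt t) * complex.Re (phi (rowt t))) +i*
  Rintegral (lebesgue_Rn n) setT (fun t => f (rowt t) * complex.Im (phi (rowt t))).
Proof.
congr (_ +i* _); apply: eq_Rintegral => t _; [exact: ReMr|exact: ImMr].
Qed.

Lemma pairing_by_parts (k : 'I_n) f f' phi : nice f -> nice f' ->
  (forall x, is_derive x (delta_mx 0 k) f (f' x)) -> schwartz phi ->
  pairing f (partial k phi) = - pairing f' phi.
Proof.
move=> nf nf' df sphi.
have [r1 r2] := schwartz_rapid sphi.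
have [r3 r4] := schwartz_rapid (schwartz_partial k sphi).
have [sp _] := sphi.
rewrite !pairingE; congr (_ +i* _).
  apply: (integral_by_parts_Rn nf nf' r1 r3 df) => x.
  have [h _] := sp [::] x.
  by apply: DeriveDef => //; exact: diff_derivable.
apply: (integral_by_parts_Rn nf nf' r2 r4 df) => x.
have [_ h] := sp [::] x.
by apply: DeriveDef => //; exact: diff_derivable.
Qed.

Definition Cintegrable g : Prop :=
  (lebesgue_Rn n).-integrable setT (EFin \o (fun t => complex.Re (g (rowt t)))) /\
  (lebesgue_Rn n).-integrable setT (EFin \o (fun t => complex.Im (g (rowt t)))).

Lemma CintegrableD g h : Cintegrable g -> Cintegrable h ->
  Cintegrable (fun x => g x + h x).
Proof.
move=> [g1 g2] [h1 h2]; split.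
- have -> : EFin \o (fun t => complex.Re (g (rowt t) + h (rowt t))) =
    (EFin \o (fun t => complex.Re (g (rowt t)))) \+
    (EFin \o (fun t => complex.Re (h (rowt t))))%E.
    by apply/funext => t /=; rewrite ReD EFinD.
  exact: integrableD.
- have -> : EFin \o (fun t => complex.Im (g (rowt t) + h (rowt t))) =
    (EFin \o (fun t => complex.Im (g (rowt t)))) \+
    (EFin \o (fun t => complex.Im (h (rowt t))))%E.
    by apply/funext => t /=; rewrite ImD EFinD.
  exact: integrableD.
Qed.

Lemma integral_RnD g h : Cintegrable g -> Cintegrable h ->
  integral_Rn (fun x => g x + h x) = integral_Rn g + integral_Rn h.
Proof.
move=> [g1 g2] [h1 h2]; apply: complex_ext; rewrite ?ReD ?ImD /integral_Rn/=.
- by rewrite -RintegralD//; apply: eq_Rintegral => t _; exact: ReD.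
- by rewrite -RintegralD//; apply: eq_Rintegral => t _; exact: ImD.
Qed.

Lemma integrable_lin (u w : n.-tuple R -> R) (a b : R) :
  (lebesgue_Rn n).-integrable setT (EFin \o u) ->
  (lebesgue_Rn n).-integrable setT (EFin \o w) ->
  (lebesgue_Rn n).-integrable setT (EFin \o (fun t => a * u t + b * w t)).
Proof.
move=> iu iw; have -> : EFin \o (fun t => a * u t + b * w t) =
    ((fun t => a%:E * (EFin \o u) t) \+ (fun t => b%:E * (EFin \o w) t))%E.
  by apply/funext => t /=; rewrite EFinD !EFinM.
by apply: integrableD => //; exact: integrableZl.
Qed.

Lemma Rintegral_lin (u w : n.-tuple R -> R) (a b : R) :
  (lebesgue_Rn n).-integrable setT (EFin \o u) ->
  (lebesgue_Rn n).-integrable setT (EFin \o w) ->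
  Rintegral (lebesgue_Rn n) setT (fun t => a * u t + b * w t) =
  a * Rintegral (lebesgue_Rn n) setT u + b * Rintegral (lebesgue_Rn n) setT w.
Proof.
move=> iu iw; rewrite RintegralD//; first by rewrite !RintegralZl.
- by apply: (@eq_integrable _ _ _ _ _ _ (fun t => a%:E * (EFin \o u) t)%E) => //;
    exact: integrableZl.
- by apply: (@eq_integrable _ _ _ _ _ _ (fun t => b%:E * (EFin \o w) t)%E) => //;
    exact: integrableZl.
Qed.

Lemma ReM (z w : C) : complex.Re (z * w) =
  complex.Re z * complex.Re w + (- complex.Im z) * complex.Im w.
Proof. by case: z => a b; case: w => c e; rewrite /= mulNr. Qed.

Lemma ImM (z w : C) : complex.Im (z * w) =
  complex.Im z * complex.Re w + complex.Re z * complex.Im w.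
Proof. by case: z => a b; case: w => c e; rewrite /= addrC. Qed.

Lemma CintegrableZ (c : C) g : Cintegrable g -> Cintegrable (fun x => c * g x).
Proof.
move=> [g1 g2]; split.
- have -> : (fun t => complex.Re (c * g (rowt t))) = (fun t => complex.Re c *
      complex.Re (g (rowt t)) + (- complex.Im c) * complex.Im (g (rowt t))).
    by apply/funext => t; exact: ReM.
  exact: integrable_lin.
- have -> : (fun t => complex.Im (c * g (rowt t))) = (fun t => complex.Im c *
      complex.Re (g (rowt t)) + complex.Re c * complex.Im (g (rowt t))).
    by apply/funext => t; exact: ImM.
  exact: integrable_lin.
Qed.

Lemma integral_RnZ (c : C) g : Cintegrable g ->
  integral_Rn (fun x => c * g x) = c * integral_Rn g.
Proof.
move=> [g1 g2]; apply: complex_ext; rewrite ?ReM ?ImM /integral_Rn/=.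
- by rewrite -Rintegral_lin//; apply: eq_Rintegral => t _; exact: ReM.
- by rewrite -Rintegral_lin//; apply: eq_Rintegral => t _; exact: ImM.
Qed.

Lemma Cintegrable_pairing f phi : nice f -> schwartz phi ->
  Cintegrable (fun x => (f x)%:C * phi x).
Proof.
move=> nf /schwartz_rapid[r1 r2]; split.
- have -> : (fun t => complex.Re ((f (rowt t))%:C * phi (rowt t))) =
      (fun t => f (rowt t) * complex.Re (phi (rowt t))).
    by apply/funext => t; exact: ReMr.
  exact: integrable_nice_rapid nf r1.
- have -> : (fun t => complex.Im ((f (rowt t))%:C * phi (rowt t))) =
      (fun t => f (rowt t) * complex.Im (phi (rowt t))).
    by apply/funext => t; exact: ImMr.
  exact: integrable_nice_rapid nf r2.
Qed.

Lemma integral_Rn_sum (I : Type) (s : seq I) (F : I -> Rn -> R) (c : I -> C) phi :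
  (forall i, nice (F i)) -> schwartz phi ->
  Cintegrable (fun x => (\sum_(i <- s) c i * (F i x)%:C) * phi x) /\
  integral_Rn (fun x => (\sum_(i <- s) c i * (F i x)%:C) * phi x) =
  \sum_(i <- s) c i * pairing (F i) phi.
Proof.
move=> nF sphi; elim: s => [|i s [ih1 ih2]].
  have -> : (fun x => (\sum_(i <- [::]) c i * (F i x)%:C) * phi x) =
      (fun x => 0 * ((0 : R)%:C * phi x)).
    by apply/funext => x; rewrite big_nil !mul0r.
  have i0 : Cintegrable (fun x => (0 : R)%:C * phi x).
    by apply: (@Cintegrable_pairing (fun=> 0)) => //; exact: nice_cst.
  by rewrite big_nil integral_RnZ// mul0r; split => //; exact: CintegrableZ.
have -> : (fun x => (\sum_(j <- i :: s) c j * (F j x)%:C) * phi x) =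
    (fun x => c i * ((F i x)%:C * phi x) + (\sum_(j <- s) c j * (F j x)%:C) * phi x).
  by apply/funext => x; rewrite big_cons mulrDl mulrA.
have i1 := Cintegrable_pairing (nF i) sphi.
split; first by apply: CintegrableD => //; exact: CintegrableZ.
by rewrite integral_RnD ?big_cons ?integral_RnZ ?ih2//; exact: CintegrableZ.
Qed.

End ComplexIntegral.

(** * The kernels for real parameters *)

Section SignedPower.
Context {R : realType}.
Implicit Types (s : bool) (a t : R).

(** The even and the odd power of |t| in one definition. Multiplication by [t] and differentiation
    both flip [s], which is the source of the exchange of K^+ and K^-. *)
Definition spow s a t : R := (if s then 1 else Num.sg t) * `|t| `^ a.

Lemma spow0 s a : a != 0 -> spow s a 0 = 0.
Proof. by move=> a0; rewrite /spow normr0 powR0// mulr0. Qed.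

Lemma spow_mul s a t : 0 < a -> spow s a t * t = spow (~~ s) (a + 1) t.
Proof.
move=> a0; have [->|t0] := eqVneq t 0.
  by rewrite mulr0 spow0// gt_eqF// addr_gt0.
have pE : `|t| `^ (a + 1) = `|t| `^ a * `|t|.
  by rewrite powRD ?powRr1 ?normr_eq0 ?t0 ?implybT.
rewrite /spow pE; case: s => /=; first by rewrite !mul1r mulrCA -numEsg.
by rewrite mul1r mulrC mulrA -[in LHS](mulrC (Num.sg t)) -normrEsg mulrC.
Qed.

Lemma spow_pos s a t : 0 < t -> spow s a t = t `^ a.
Proof. by move=> t0; rewrite /spow gtr0_norm// gtr0_sg//; case: s; rewrite mul1r. Qed.

Lemma spow_neg s a t : t < 0 -> spow s a t = (if s then 1 else -1) * (- t) `^ a.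
Proof. by move=> t0; rewrite /spow ltr0_norm// ltr0_sg. Qed.

Lemma spow_norm_le s a t : `|spow s a t| <= `|t| `^ a.
Proof.
rewrite normrM [X in _ * X]ger0_norm ?powR_ge0// ler_piMl ?powR_ge0//.
by case: s; rewrite ?normr1// normr_sg; case: (t != 0).
Qed.

(* For [2 <= a] the function is bounded by [t ^+ 2] near 0, which settles the
   derivative there. *)
Lemma is_derive_spow s a t : 2 <= a ->
  is_derive t 1 (spow s a) (a * spow (~~ s) (a - 1) t).
Proof.
move=> a2; have [t0|t0|->] := ltgtP t 0.
- have d : is_derive t 1 (fun y => (if s then 1 else -1) * (- y) `^ a)
      (a * spow (~~ s) (a - 1) t).
    have dN : is_derive t 1 (-%R : R -> R) (-1) by exact: is_deriveNid.
    have dp : is_derive (- t) 1 ((@powR R)^~ a) (a * (- t) `^ (a - 1)).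
      by apply: is_derive1_powR; rewrite oppr_gt0.
    have dc := is_derive1_comp dp dN.
    apply: (is_derive_eq (is_deriveZ (if s then 1 else -1) dc)).
    rewrite spow_neg//; case: s => /=; rewrite /GRing.scale/=; ring.
  apply: near_eq_is_derive d.
  have : nbhs t [set y | y < 0] by exact: lt_nbhsl.
  by apply: filterS => y /= y0; rewrite spow_neg.
- have d : is_derive t 1 ((@powR R)^~ a) (a * t `^ (a - 1)) by exact: is_derive1_powR.
  rewrite spow_pos//; apply: near_eq_is_derive d.
  have : nbhs t [set y | 0 < y] by exact: lt_nbhsr.
  by apply: filterS => y /= y0; rewrite spow_pos.
- have a1 : a - 1 != 0 by rewrite gt_eqF//; lra.
  have a0 : a != 0 by rewrite gt_eqF//; lra.
  rewrite spow0// mulr0.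
  have cv : h^-1 *: ((spow s a \o shift 0) (h *: 1) - spow s a 0) @[h --> (0 : R)^'] --> (0 : R).
    rewrite /= spow0//; apply/cvgrPdist_le => e e0; near=> h.
    have h0 : h != 0 by near: h; exact: nbhs_dnbhs_neq.
    have he : `|h| <= Num.min e 1.
      near: h; apply: (@dnbhs0_le R R); by rewrite lt_min e0 ltr01.
    move: he; rewrite le_min => /andP[he h1].
    rewrite sub0r normrN subr0 addr0 [h%:A]mulr1 normrM normfV.
    rewrite ler_pdivrMl ?normr_gt0// (le_trans (spow_norm_le _ _ _))//.
    apply: (@le_trans _ _ (`|h| `^ 2%:R)).
      rewrite -[a](subrKC 2%:R) powRD ?normr_eq0 ?h0 ?implybT//.
      rewrite ler_piMr ?powR_ge0//.
      apply: (@le_trans _ _ (1 `^ (a - 2%:R))); last by rewrite powR1.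
      by rewrite ge0_ler_powR// ?nnegrE// subr_ge0.
    by rewrite powR_mulrn// expr2 ler_wpM2l.
  apply: DeriveDef; first by apply/cvg_ex; exists 0.
  by apply: cvg_lim cv; exact: Rhausdorff.
Unshelve. all: by end_near. Qed.

Lemma differentiable_spow s a t : 2 <= a -> differentiable (spow s a) t.
Proof.
move=> a2; apply/derivable1_diffP.
exact: (@ex_derive _ _ _ _ _ _ _ (is_derive_spow s t a2)).
Qed.

End SignedPower.

Section Chain.
Context {R : realType} {V : normedModType R}.

Lemma is_derive_comp_diff (f : R -> R) (g : V -> R) (x v : V) (df dg : R) :
  is_derive (g x) 1 f df -> differentiable g x -> is_derive x v g dg ->
  is_derive x v (f \o g) (df * dg).
Proof.
move=> hf hg dgv; have df1 := @ex_derive _ _ _ _ _ _ _ hf.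
have hf' : differentiable f (g x) by apply/derivable1_diffP.
apply: DeriveDef; first by apply: diff_derivable; exact: differentiable_comp.
rewrite deriveE; last exact: differentiable_comp.
rewrite diff_comp// /= -(@deriveE _ _ _ g x v hg) (@derive_val _ _ _ _ _ _ _ dgv).
rewrite diff1E// derive1E.
by rewrite (@derive_val _ _ _ _ _ _ _ hf) mulrC.
Qed.

End Chain.

Section KernelFunctions.
Context {R : realType}.
Variable m : nat.
Local Notation n := m.+1.
Local Notation Rn := 'rV[R]_n.
Implicit Types (x : Rn) (s t : bool) (a b : R).

Definition sqnorm x : R := \sum_k x 0 k ^+ 2.

Lemma sqnormE x : sqnorm x = sqnorm' x + lastc x ^+ 2.
Proof. by rewrite /sqnorm big_ord_recr. Qed.

Lemma sqnorm_ge0 x : 0 <= sqnorm x.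
Proof. by apply: sumr_ge0 => k _; exact: sqr_ge0. Qed.

Lemma is_derive_coord (k j : 'I_n) x :
  is_derive x (delta_mx 0 k) (fun y : Rn => y 0 j) (j == k)%:R.
Proof.
apply: DeriveDef; last exact: derive_coord.
by apply: diff_derivable; exact: differentiable_coord.
Qed.

Lemma sqnorm_fctE : sqnorm = \sum_(k < n) (fun y : Rn => y 0 k) ^+ 2.
Proof. by apply/funext => x; rewrite fct_sumE. Qed.

Lemma differentiable_sqnorm x : differentiable sqnorm x.
Proof.
rewrite sqnorm_fctE; apply: differentiable_sum => k.
by apply: differentiableX; exact: differentiable_coord.
Qed.

Lemma is_derive_sqnorm (k : 'I_n) x :
  is_derive x (delta_mx 0 k) sqnorm (2 * x 0 k).
Proof.
rewrite sqnorm_fctE.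
have := is_derive_sum (fun j => is_deriveX 2 (is_derive_coord k j x)).
move=> d; apply: (is_derive_eq d).
rewrite (bigD1 k)//= big1 ?addr0 => [|j jk].
  by rewrite eqxx expr1 [_ *: _]mulr1.
by rewrite (negbTE jk) scaler0.
Qed.

(** The power of x_n with exponent [a] times |x|^(2b). The flag [t] follows the parity flips of the
    second factor, so that both factors obey [is_derive_spow] and [spow_mul]. *)
Definition kfun s a t b x : R := spow s a (lastc x) * spow t b (sqnorm x).

Lemma is_derive_kfun s a t b (k : 'I_n) x : 2 <= a -> 2 <= b ->
  is_derive x (delta_mx 0 k) (kfun s a t b)
    ((k == ord_max)%:R * a * kfun (~~ s) (a - 1) t b x
     + 2 * b * x 0 k * kfun s a (~~ t) (b - 1) x).
Proof.
move=> a2 b2.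
have d1 := is_derive_comp_diff (is_derive_spow s (lastc x) a2)
  (differentiable_coord x 0 ord_max) (is_derive_coord k ord_max x).
have d2 := is_derive_comp_diff (is_derive_spow t (sqnorm x) b2)
  (differentiable_sqnorm x) (is_derive_sqnorm k x).
apply: (is_derive_eq (is_deriveM d1 d2)).
by rewrite /kfun /GRing.scale/= [_ == k]eq_sym; ring.
Qed.

Lemma nice_spow s a (g : Rn -> R) : 2 <= a -> nice g -> nice (fun x => spow s a (g x)).
Proof.
move=> a2 [cg /polybounded_ge0[p [A [A0 gA]]]]; split.
  move=> x; apply: (continuous_comp (cg x)); apply: differentiable_continuous.
  exact: differentiable_spow.
have a0 : 0 <= a by lra.
(* An integer above [a]: it turns the real power into a polynomial bound. *)
pose K := (Num.truncn a).+1.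
exists (p * K)%N, ((1 + A) ^+ K) => x.
have g1 : 1 <= 1 + `|g x| by rewrite lerDl.
apply: le_trans (spow_norm_le _ _ _) _.
apply: (@le_trans _ _ ((1 + `|g x|) `^ a)).
  by rewrite ge0_ler_powR ?nnegrE// ?addr_ge0// lerDr.
apply: (@le_trans _ _ ((1 + `|g x|) `^ K%:R)).
  by rewrite ler_powR// ltW// truncnS_gt.
rewrite powR_mulrn ?addr_ge0// exprM -exprMn lerXn2r ?nnegrE ?addr_ge0 ?mulr_ge0 ?exprn_ge0 ?addr_ge0//.
rewrite mulrDl mul1r lerD// exprn_ege1// norm1_ge1//.
Qed.

Lemma nice_sqnorm : nice sqnorm.
Proof. by apply: nice_sum => k; apply: niceX; exact: nice_coord. Qed.

Lemma nice_kfun s a t b : 2 <= a -> 2 <= b -> nice (kfun s a t b).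
Proof.
move=> a2 b2; apply: niceM; apply: nice_spow => //; first exact: nice_coord.
exact: nice_sqnorm.
Qed.

Lemma kfun_lastc s a t b x : 0 < a ->
  kfun s a t b x * lastc x = kfun (~~ s) (a + 1) t b x.
Proof. by move=> a0; rewrite /kfun mulrAC spow_mul. Qed.

Lemma kfun_sqnorm s a t b x : 0 < b ->
  kfun s a t b x * sqnorm x = kfun s a (~~ t) (b + 1) x.
Proof. by move=> a0; rewrite /kfun -mulrA spow_mul. Qed.

End KernelFunctions.

(** * Clifford algebra and the shift identity *)

Section Clifford.
Context {R : realType}.
Variables (n N : nat).
Local Notation C := R[i].
Variable gamma : 'I_n -> 'M[C]_N.
Hypothesis cliff : forall j k, gamma j *m gamma k + gamma k *m gamma j
                  = (- 2 * (j == k)%:R)%:M.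
Implicit Types (x : 'rV[R]_n) (e k : 'I_n).

Lemma half_mx (A : 'M[C]_N) (c : C) : A + A = (2 * c)%:M -> A = c%:M.
Proof.
move=> h; apply: (scalerI (_ : (2 : C) != 0)); first by rewrite pnatr_eq0.
by rewrite scale_scalar_mx -h scaler_nat mulr2n.
Qed.

Lemma gamma_sqr k : gamma k *m gamma k = (-1)%:M.
Proof. by apply: half_mx; rewrite cliff eqxx mulr1 mulrN1. Qed.

Lemma clifford_anticomm x k :
  clifford gamma x *m gamma k + gamma k *m clifford gamma x = (- 2 * (x 0 k)%:C)%:M.
Proof.
rewrite /clifford mulmx_suml mulmx_sumr -big_split/=.
rewrite (bigD1 k)//= big1 ?addr0 => [|j jk].
  rewrite -scalemxAl -scalemxAr -scalerDr cliff eqxx scale_scalar_mx mulr1.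
  by rewrite mulrC.
by rewrite -scalemxAl -scalemxAr -scalerDr cliff (negbTE jk) mulr0 scale_scalar_mx
  mulr0 raddf0.
Qed.

(** Twice the square is the sum over [k] of x_k times the anticommutator of [X] with [gamma k], and
    these are scalar. *)
Lemma clifford_sqr x :
  clifford gamma x *m clifford gamma x = (- (\sum_k x 0 k ^+ 2)%:C)%:M.
Proof.
apply: half_mx; set X := clifford gamma x.
transitivity (\sum_k (x 0 k)%:C *: (X *m gamma k + gamma k *m X)).
  under eq_bigr => k _ do rewrite scalerDr scalemxAr scalemxAl.
  by rewrite big_split/= -mulmx_sumr -mulmx_suml.
under eq_bigr => k _ do rewrite clifford_anticomm scale_scalar_mx.
rewrite -raddf_sum/= mulrN; congr (_%:M).
rewrite rmorph_sum/= mulr_sumr -sumrN; apply: eq_bigr => k _.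
rewrite rmorphXn/=; ring.
Qed.

Lemma clifford_reflect x e : clifford gamma x *m gamma e *m clifford gamma x =
  (\sum_k x 0 k ^+ 2)%:C *: gamma e - (2 * (x 0 e)%:C) *: clifford gamma x.
Proof.
have -> : clifford gamma x *m gamma e =
    (- 2 * (x 0 e)%:C)%:M - gamma e *m clifford gamma x.
  by rewrite -(clifford_anticomm x e) addrK.
rewrite mulmxBl -mulmxA clifford_sqr mul_scalar_mx mul_mx_scalar scaleNr opprK addrC.
by rewrite mulNr scaleNr.
Qed.

Lemma gamma_contract e :
  \sum_k gamma k *m gamma e *m gamma k = (n%:R - 2) *: gamma e.
Proof.
transitivity (\sum_k (gamma e - (2 * (k == e)%:R) *: gamma k)).
  apply: eq_bigr => k _.
  have -> : gamma k *m gamma e = (- 2 * (k == e)%:R)%:M - gamma e *m gamma k.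
    by rewrite -(cliff k e) addrK.
  rewrite mulmxBl -mulmxA gamma_sqr mul_scalar_mx mul_mx_scalar scaleN1r opprK addrC.
  by rewrite mulNr scaleNr.
rewrite sumrB sumr_const card_ord scalerBl scaler_nat; congr (_ - _).
rewrite (bigD1 e)//= big1 ?addr0 ?eqxx ?mulr1// => k ke.
by rewrite (negbTE ke) mulr0 scale0r.
Qed.

End Clifford.

(** * Entrywise integrals of matrix-valued functions *)

Section MatrixIntegral.
Context {R : realType}.
Variables (n N : nat).
Local Notation C := R[i].
Local Notation Rn := 'rV[R]_n.
Implicit Types (F G : Rn -> 'M[C]_N) (phi : Rn -> C) (S : 'M[C]_N).

(** Integrability travels together with the value, so a sum of pairings can be assembled term by
    term. [mx_integral_unique] then reduces an equality of such sums to a pointwise one. *)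
Definition mx_integral F phi S : Prop := forall i j,
  Cintegrable (fun x => F x i j * phi x) /\
  integral_Rn (fun x => F x i j * phi x) = S i j.

Lemma mx_integral_unique F G phi S S' : mx_integral F phi S ->
  mx_integral G phi S' -> (forall x, F x = G x) -> S = S'.
Proof.
move=> hF hG FG; apply/matrixP => i j.
rewrite -(proj2 (hF i j)) -(proj2 (hG i j)); congr integral_Rn.
by apply/funext => x; rewrite FG.
Qed.

Lemma mx_integral_term (f : Rn -> R) (A : 'M[C]_N) phi : nice f -> schwartz phi ->
  mx_integral (fun x => (f x)%:C *: A) phi (pairing f phi *: A).
Proof.
move=> nf sphi i j.
have -> : (fun x => ((f x)%:C *: A) i j * phi x) =
    (fun x => A i j * ((f x)%:C * phi x)).
  by apply/funext => x; rewrite mxE mulrAC mulrC.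
have i0 := Cintegrable_pairing nf sphi.
by rewrite mxE mulrC; split; [exact: CintegrableZ|exact: integral_RnZ].
Qed.

Lemma mx_integralD F G phi S S' : mx_integral F phi S -> mx_integral G phi S' ->
  mx_integral (fun x => F x + G x) phi (S + S').
Proof.
move=> hF hG i j; have [iF EF] := hF i j; have [iG EG] := hG i j.
have -> : (fun x => (F x + G x) i j * phi x) =
    (fun x => F x i j * phi x + G x i j * phi x).
  by apply/funext => x; rewrite mxE mulrDl.
by rewrite mxE -EF -EG; split; [exact: CintegrableD|exact: integral_RnD].
Qed.

Lemma mx_integralZ F phi S c : mx_integral F phi S ->
  mx_integral (fun x => c *: F x) phi (c *: S).
Proof.
move=> hF i j; have [iF E] := hF i j.
have -> : (fun x => (c *: F x) i j * phi x) = (fun x => c * (F x i j * phi x)).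
  by apply/funext => x; rewrite mxE mulrA.
by rewrite mxE -E; split; [exact: CintegrableZ|exact: integral_RnZ].
Qed.

Lemma mx_integral_sum (I : Type) (r : seq I) (F : I -> Rn -> 'M[C]_N) phi
    (S : I -> 'M[C]_N) : schwartz phi ->
  (forall i, mx_integral (F i) phi (S i)) ->
  mx_integral (fun x => \sum_(i <- r) F i x) phi (\sum_(i <- r) S i).
Proof.
move=> sphi hF; elim: r => [|i r ih].
  have h0 := mx_integral_term 0 (nice_cst _ 0) sphi.
  have -> : (fun x => \sum_(i <- [::]) F i x) = (fun x => (0 : R)%:C *: (0 : 'M[C]_N)).
    by apply/funext => x; rewrite big_nil scaler0.
  by move: h0; rewrite big_nil !scaler0.
have -> : (fun x => \sum_(j <- i :: r) F j x) =
    (fun x => F i x + \sum_(j <- r) F j x).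
  by apply/funext => x; rewrite big_cons.
by rewrite big_cons; exact: mx_integralD.
Qed.

End MatrixIntegral.

Section Kernel.
Context {R : realType}.
Variables (m N : nat).
Local Notation n := m.+1.
Local Notation C := R[i].
Local Notation Rn := 'rV[R]_n.
Variable gamma : 'I_n -> 'M[C]_N.
Implicit Types (s : bool) (l v a b : R) (x : Rn) (phi : Rn -> C).
Let P := spinor_proj gamma.

(** The value 1 for [t <= 0] comes from the convention [ln t = 0] there; it differs from [powR] at
    0. *)
Lemma cpowE (t z : R) : cpow t z%:C = if 0 < t then (t `^ z)%:C else 1.
Proof.
rewrite /cpow /cexp -rmorphM/= sin0 cos0 mulr1.
case: ltP => t0; first by rewrite /powR gt_eqF.
by rewrite ln0// mulr0 expR0.
Qed.

Definition kernel_coef s a b (j : 'I_n) x : R := kfun s a true b x * x 0 j.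

Lemma nice_kernel_coef s a b j : 2 <= a -> 2 <= b -> nice (kernel_coef s a b j).
Proof. by move=> a2 b2; apply: niceM; [exact: nice_kfun|exact: nice_coord]. Qed.

(* On the hyperplane [lastc x = 0] the convention [cpow 0 z = 1] gives the kernel
   a value that differs from the continuous one. *)
Lemma spinor_kernelE s l v a b x i j : 2 <= a -> 2 <= b ->
  a = l + v - n%:R -> b = - (v + 2^-1) ->
  spinor_kernel gamma s l%:C v%:C x i j =
  if lastc x == 0
  then \sum_k (gamma k *m P) i j *
         ((if s then 1 else 0) * (spow true b (sqnorm x) * x 0 k))%:C
  else \sum_k (gamma k *m P) i j * (kernel_coef s a b k x)%:C.
Proof.
move=> a2 b2 aE bE; rewrite /spinor_kernel /Defs.kernel -/P.
have -> : l%:C - 2^-1 + (v%:C + 2^-1) - n%:R = a%:C.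
  by rewrite aE rmorphB rmorphD rmorph_nat/=; ring.
have -> : - (v%:C + 2^-1) = b%:C.
  by rewrite bE rmorphN rmorphD/= fmorphV rmorph_nat.
rewrite -sqnormE !cpowE mxE /clifford mulmx_suml summxE mulr_sumr.
have bn0 : b != 0 by rewrite gt_eqF//; lra.
have E (r : R) : 0 <= r -> `|r| = r by exact: ger0_norm.
have spE : spow true b (sqnorm x) = if 0 < sqnorm x then sqnorm x `^ b else 0.
  rewrite /spow mul1r E ?sqnorm_ge0//; case: ltP => // h.
  have -> : sqnorm x = 0 by apply/eqP; rewrite eq_le h sqnorm_ge0.
  by rewrite powR0.
(* On the hyperplane the power of x_n evaluates to 1, so the sign factor, 1 or [Num.sg 0 = 0], is
   all that remains of it. *)
case: eqP => x0.
  apply: eq_bigr => k _; rewrite x0 normr0 ltxx sgr0 mulr1 -scalemxAl mxE spE.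
  rewrite [in RHS]mulrC mulrA; congr (_ * _).
  case: ltP => h; first by rewrite -!rmorphM/= mulrA; case: s.
  (* At the origin [cpow] gives 1 and [spow] gives 0; the factor [x 0 k = 0] reconciles them. *)
  have q0 : sqnorm x = 0 by apply/eqP; rewrite eq_le h sqnorm_ge0.
  have xk : x 0 k ^+ 2 = 0 by apply: (psumr_eq0P _ q0) => // i0 _; exact: sqr_ge0.
  have -> : x 0 k = 0 by apply/eqP; rewrite -sqrf_eq0 xk.
  by rewrite !mulr0.
apply: eq_bigr => k _; rewrite -scalemxAl mxE [in RHS]mulrC mulrA; congr (_ * _).
have s0 : 0 < sqnorm x.
  rewrite sqnormE ltr_wpDl//; last by rewrite exprn_even_gt0//=; apply/eqP.
  by apply: sumr_ge0 => ? _; exact: sqr_ge0.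
rewrite s0 normr_gt0; have /eqP -> := x0.
rewrite /kernel_coef /kfun spE s0 /spow -!rmorphM/=; congr (_%:C).
Qed.

End Kernel.

(** * Derivatives of the kernel and the pointwise identity *)

Section ShiftIdentity.
Context {R : realType}.
Variables (m N : nat).
Local Notation n := m.+1.
Local Notation C := R[i].
Local Notation Rn := 'rV[R]_n.
Variable gamma : 'I_n -> 'M[C]_N.
Implicit Types (s : bool) (l v a b : R) (x : Rn) (phi : Rn -> C) (j k : 'I_n).
Let P := spinor_proj gamma.
Let e : 'I_n := ord_max.

(** The pairing with the continuous representative of the kernel, expanded over the constant
    matrices [gamma k *m P]; all analysis is left in real coefficient functions. *)
Definition kernel_pairing s a b phi : 'M[C]_N :=
  \sum_k pairing (kernel_coef s a b k) phi *: (gamma k *m P).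

Lemma kernel_functionalE s l v a b phi : 2 <= a -> 2 <= b ->
  a = l + v - n%:R -> b = - (v + 2^-1) -> schwartz phi ->
  kernel_functional gamma s l%:C v%:C phi = kernel_pairing s a b phi.
Proof.
move=> a2 b2 aE bE sphi; apply/matrixP => i j; rewrite mxE summxE.
pose c k := (gamma k *m P) i j.
have nF k : nice (kernel_coef s a b k) by exact: nice_kernel_coef.
have nH k : nice (fun x : Rn =>
    (if s then 1 else 0) * (spow true b (sqnorm x) * x 0 k)).
  apply: niceM; first exact: nice_cst.
  apply: niceM; last exact: nice_coord.
  by apply: nice_spow => //; exact: nice_sqnorm.
have [[r1 i1] E1] := integral_Rn_sum (index_enum 'I_n) c nF sphi.
have [[r0 i0] _] := integral_Rn_sum (index_enum 'I_n) c nH sphi.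
transitivity (\sum_k c k * pairing (kernel_coef s a b k) phi); last first.
  by apply: eq_bigr => k _; rewrite mxE mulrC.
rewrite -E1.
have meas (u : n.-tuple R -> R) :
    (lebesgue_Rn n).-integrable setT (EFin \o u) -> measurable_fun setT u.
  by move=> /measurable_int /measurable_EFinP.
congr (_ +i* _).
- apply: (Rintegral_off_hyperplane (k := e) (meas _ r1) (meas _ r0)) => t.
  by rewrite (spinor_kernelE _ _ _ _ _ a2 b2 aE bE) /lastc mxE; case: ifP.
- apply: (Rintegral_off_hyperplane (k := e) (meas _ i1) (meas _ i0)) => t.
  by rewrite (spinor_kernelE _ _ _ _ _ a2 b2 aE bE) /lastc mxE; case: ifP.
Qed.

(** With u = [kfun s a true b], [dkfun] and [ddkfun] are the first and second derivatives of u along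
    e_k, [dkernel_coef] and [ddkernel_coef] those of u x_j. Lowered exponents replace quotients, so
    the formulas hold on x_n = 0 as well. *)
Definition dkfun s a b k x : R :=
  (k == e)%:R * a * kfun (~~ s) (a - 1) true b x
  + 2 * b * x 0 k * kfun s a false (b - 1) x.

Definition dkernel_coef s a b k j x : R :=
  dkfun s a b k x * x 0 j + kfun s a true b x * (j == k)%:R.

Definition ddkfun s a b k x : R :=
  (k == e)%:R * a * ((k == e)%:R * (a - 1) * kfun s (a - 1 - 1) true b x
    + 2 * b * x 0 k * kfun (~~ s) (a - 1) false (b - 1) x)
  + 2 * b * (kfun s a false (b - 1) x
    + x 0 k * ((k == e)%:R * a * kfun (~~ s) (a - 1) false (b - 1) x
      + 2 * (b - 1) * x 0 k * kfun s a true (b - 1 - 1) x)).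

Definition ddkernel_coef s a b k j x : R :=
  ddkfun s a b k x * x 0 j + 2 * dkfun s a b k x * (j == k)%:R.

Lemma is_derive_kernel_coef s a b k j x : 2 <= a -> 2 <= b ->
  is_derive x (delta_mx 0 k) (kernel_coef s a b j) (dkernel_coef s a b k j x).
Proof.
move=> a2 b2.
apply: (is_derive_eq (is_deriveM (is_derive_kfun s true k x a2 b2) (is_derive_coord k j x))).
by rewrite /dkernel_coef /dkfun /GRing.scale/=; ring.
Qed.

Lemma is_derive_dkfun s a b k x : 3 <= a -> 3 <= b ->
  is_derive x (delta_mx 0 k) (dkfun s a b k) (ddkfun s a b k x).
Proof.
move=> a3 b3.
have a2 : 2 <= a by lra. have b2 : 2 <= b by lra.
have a12 : 2 <= a - 1 by lra. have b12 : 2 <= b - 1 by lra.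
have d1 := is_derive_kfun (~~ s) true k x a12 b2.
have d2 := is_derive_kfun s false k x a2 b12.
have dk := is_derive_coord k k x.
have dd := is_deriveD (is_deriveZ ((k == e)%:R * a) d1)
  (is_deriveM (is_deriveZ (2 * b) dk) d2).
have scE (c d : R) : c *: d = c * d by [].
apply: (is_derive_eq dd).
by rewrite /ddkfun /e eqxx negbK/= !scE; ring.
Qed.

Lemma is_derive_dkernel_coef s a b k j x : 3 <= a -> 3 <= b ->
  is_derive x (delta_mx 0 k) (dkernel_coef s a b k j) (ddkernel_coef s a b k j x).
Proof.
move=> a3 b3.
have a2 : 2 <= a by lra. have b2 : 2 <= b by lra.
have d0 := is_derive_kfun s true k x a2 b2.
have dj := is_derive_coord k j x.
have dd := is_derive_dkfun s k x a3 b3.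
have dc := is_derive_cst ((j == k)%:R : R) x (delta_mx 0 k).
have scE (c d : R) : c *: d = c * d by [].
apply: (is_derive_eq (is_deriveD (is_deriveM dd dj) (is_deriveM d0 dc))).
by rewrite /ddkernel_coef !scE /dkfun /e/=; ring.
Qed.

Lemma nice_dkfun s a b k : 3 <= a -> 3 <= b -> nice (dkfun s a b k).
Proof.
move=> a3 b3; apply: niceD; apply: niceM; try exact: nice_cst.
- by apply: nice_kfun; lra.
- by apply: niceM; [exact: nice_cst|exact: nice_coord].
- by apply: nice_kfun; lra.
Qed.

Lemma nice_dkernel_coef s a b k j : 3 <= a -> 3 <= b -> nice (dkernel_coef s a b k j).
Proof.
move=> a3 b3; apply: niceD; apply: niceM.
- exact: nice_dkfun.
- exact: nice_coord.
- by apply: nice_kfun; lra.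
- exact: nice_cst.
Qed.

(** The bound 4 is sharp for this argument: two derivatives lower an exponent by 2, and [nice_kfun]
    asks for exponents of at least 2. *)
Lemma nice_ddkernel_coef s a b k j : 4 <= a -> 4 <= b -> nice (ddkernel_coef s a b k j).
Proof.
move=> a4 b4.
have nk s' a' t' b' : 2 <= a' -> 2 <= b' -> nice (@kfun R m s' a' t' b').
  exact: nice_kfun.
have nc c : nice (fun _ : Rn => c) by exact: nice_cst.
have nx i : nice (fun x : Rn => x 0 i) by exact: nice_coord.
have nd : nice (dkfun s a b k) by apply: nice_dkfun; lra.
apply: niceD; apply: niceM => //; last by apply: niceM.
apply: niceD; apply: niceM => //; apply: niceD; try (apply: nk; lra).
- by apply: niceM => //; apply: nk; lra.
- by apply: niceM; [apply: niceM|apply: nk; lra].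
- apply: niceM => //; apply: niceD; apply: niceM; try exact: nc; try (apply: nk; lra).
  by apply: niceM.
Qed.

Lemma pairing_coord (f : Rn -> R) j phi :
  pairing f (fun x => (x 0 j)%:C * phi x) = pairing (fun x => f x * x 0 j) phi.
Proof.
by congr integral_Rn; apply/funext => x; rewrite rmorphM mulrA.
Qed.

(** The coordinate is absorbed into the kernel first, which flips the parity and raises [a] by 1;
    then two integrations by parts follow, their signs cancelling. *)
Lemma pairing_laplace_test s a b k j phi : 4 <= a -> 4 <= b -> schwartz phi ->
  pairing (kernel_coef s a b j) (laplace_test k phi) =
  pairing (ddkernel_coef (~~ s) (a + 1) b k j) phi.
Proof.
move=> a4 b4 sphi; rewrite /laplace_test pairing_coord.
have -> : (fun x => kernel_coef s a b j x * x 0 ord_max) =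
    kernel_coef (~~ s) (a + 1) b j.
  apply/funext => x; rewrite /kernel_coef -kfun_lastc ?/lastc; last lra.
  by rewrite mulrAC.
have n0 : nice (kernel_coef (~~ s) (a + 1) b j) by apply: nice_kernel_coef; lra.
have n1 : nice (dkernel_coef (~~ s) (a + 1) b k j) by apply: nice_dkernel_coef; lra.
have n2 : nice (ddkernel_coef (~~ s) (a + 1) b k j) by apply: nice_ddkernel_coef; lra.
have d0 x : is_derive x (delta_mx 0 k) (kernel_coef (~~ s) (a + 1) b j)
    (dkernel_coef (~~ s) (a + 1) b k j x) by apply: is_derive_kernel_coef; lra.
have d1 x : is_derive x (delta_mx 0 k) (dkernel_coef (~~ s) (a + 1) b k j)
    (ddkernel_coef (~~ s) (a + 1) b k j x) by apply: is_derive_dkernel_coef; lra.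
by rewrite (pairing_by_parts n0 n1 d0 (schwartz_partial k sphi))
  (pairing_by_parts n1 n2 d1 sphi) opprK.
Qed.

Hypothesis cliff : forall j k, gamma j *m gamma k + gamma k *m gamma j
                  = (- 2 * (j == k)%:R)%:M.

(** Every term of the operator is brought to the form p X + q e_n, so the identity becomes two
    scalar ones. *)
Lemma lin_comb (p q p' q' : R) (A B : 'M[C]_N) :
  (p%:C *: A + q%:C *: B) + (p'%:C *: A + q'%:C *: B) =
  (p + p')%:C *: A + (q + q')%:C *: B.
Proof. by rewrite addrACA -!scalerDl -!rmorphD. Qed.

Lemma sum_gamma (p q : R) k x :
  \sum_j (p * x 0 j + q * (j == k)%:R)%:C *: gamma j =
  p%:C *: clifford gamma x + q%:C *: gamma k.
Proof.
under eq_bigr => j _ do rewrite rmorphD scalerDl.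
rewrite big_split/=; congr (_ + _).
  by rewrite /clifford scaler_sumr; apply: eq_bigr => j _; rewrite scalerA rmorphM.
rewrite (bigD1 k)//= big1 ?addr0 ?eqxx ?mulr1// => j jk.
by rewrite (negbTE jk) mulr0 scale0r.
Qed.

Lemma sum_gamma_dkfun s a b x :
  \sum_k (dkfun s a b k x)%:C *: gamma k =
  (2 * b * kfun s a false (b - 1) x)%:C *: clifford gamma x
  + (a * kfun (~~ s) (a - 1) true b x)%:C *: gamma e.
Proof.
rewrite -sum_gamma; apply: eq_bigr => k _; congr (_%:C *: _).
by rewrite /dkfun; ring.
Qed.

Lemma dirac_identity s a b x : 2 <= a -> 3 <= b ->
  \sum_k \sum_j (dkernel_coef s a b k j x)%:C *: (gamma k *m gamma e *m gamma j) =
  (- a * kfun (~~ s) (a - 1) true b x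
    - 4 * b * x 0 e * kfun s a false (b - 1) x)%:C *: clifford gamma x
  + ((2 * b + n%:R - 2) * kfun s a true b x)%:C *: gamma e.
Proof.
move=> a2 b3.
(* Leibniz rule: the derivatives of u give its gradient as a Clifford vector, acting on e_n X; those
   of x give the contraction of e_n. *)
transitivity ((\sum_k (dkfun s a b k x)%:C *: gamma k) *m gamma e *m clifford gamma x
    + (kfun s a true b x)%:C *: \sum_k gamma k *m gamma e *m gamma k).
  rewrite !mulmx_suml scaler_sumr -big_split/=; apply: eq_bigr => k _.
  under eq_bigr => j _ do rewrite scalemxAr.
  rewrite -mulmx_sumr sum_gamma mulmxDr -!scalemxAr; congr (_ + _).
  by rewrite -!scalemxAl.
(* Off the singular set [u2] is u / |x|^2 and [u1] is u / x_n. *)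
set X := clifford gamma x; set u2 := kfun s a false (b - 1) x.
set u1 := kfun (~~ s) (a - 1) true b x; set u := kfun s a true b x.
have h1 : (2 * b * u2)%:C *: X *m gamma e *m X =
    (- (4 * b * x 0 e * u2))%:C *: X + (2 * b * u)%:C *: gamma e.
  have -> : u = u2 * sqnorm x by rewrite /u2 kfun_sqnorm ?subrK//; lra.
  rewrite -!scalemxAl clifford_reflect// -/(sqnorm x) -/X scalerBr !scalerA addrC.
  rewrite -scaleNr; congr (_ *: _ + _ *: _).
    by rewrite !(rmorphN, rmorphM, rmorph_nat)/=; ring.
  by rewrite !(rmorphN, rmorphM, rmorph_nat)/=; ring.
have h2 : (a * u1)%:C *: gamma e *m gamma e *m X =
    (- (a * u1))%:C *: X + (0 : R)%:C *: gamma e.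
  rewrite -!scalemxAl gamma_sqr// mul_scalar_mx scaleN1r scalerN scale0r addr0.
  by rewrite rmorphN scaleNr.
have h3 : u%:C *: ((n%:R - 2) *: gamma e) =
    (0 : R)%:C *: X + ((n%:R - 2) * u)%:C *: gamma e.
  rewrite scale0r add0r scalerA; congr (_ *: _).
  rewrite !(rmorphM, rmorphD, rmorphN, rmorph_nat)/=; ring.
rewrite sum_gamma_dkfun gamma_contract// !mulmxDl h1 h2 h3 !lin_comb.
congr (_%:C *: _ + _%:C *: _); ring.
Qed.

Lemma sum_ddkfun s a b x : 3 <= a -> 3 <= b ->
  \sum_k ddkfun s a b k x =
  a * dkfun (~~ s) (a - 1) b e x + 2 * b * (n%:R * kfun s a false (b - 1) x
    + a * x 0 e * kfun (~~ s) (a - 1) false (b - 1) x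
    + 2 * (b - 1) * kfun s a false (b - 1) x).
Proof.
move=> a3 b3.
transitivity (\sum_k ((k == e)%:R * (a * dkfun (~~ s) (a - 1) b k x
      + 2 * b * a * x 0 k * kfun (~~ s) (a - 1) false (b - 1) x)
    + (2 * b * kfun s a false (b - 1) x
    + 4 * b * (b - 1) * kfun s a true (b - 1 - 1) x * x 0 k ^+ 2))).
  apply: eq_bigr => k _; rewrite /ddkfun /dkfun negbK.
  by case: (k == e); ring.
rewrite big_split/= (bigD1 e)//= eqxx mul1r big1 ?addr0 => [|k ke]; last first.
  by rewrite (negbTE ke) mul0r.
rewrite big_split/= sumr_const card_ord -mulr_sumr.
(* The squares of the coordinates add up to |x|^2, which restores one of the two lost powers. *)
have <- : kfun s a true (b - 1 - 1) x * \sum_k x 0 k ^+ 2 = kfun s a false (b - 1) x.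
  by rewrite kfun_sqnorm ?subrK//; lra.
rewrite -[_ *+ n]mulr_natl; ring.
Qed.

Lemma laplace_identity s a b x : 4 <= a -> 4 <= b ->
  \sum_k \sum_j (ddkernel_coef s a b k j x)%:C *: gamma j =
  (a * dkfun (~~ s) (a - 1) b e x + 2 * b * (n%:R * kfun s a false (b - 1) x
    + a * x 0 e * kfun (~~ s) (a - 1) false (b - 1) x
    + 2 * (b - 1) * kfun s a false (b - 1) x)
    + 4 * b * kfun s a false (b - 1) x)%:C *: clifford gamma x
  + (2 * a * kfun (~~ s) (a - 1) true b x)%:C *: gamma e.
Proof.
move=> a4 b4.
transitivity ((\sum_k ddkfun s a b k x)%:C *: clifford gamma x
    + 2 *: \sum_k (dkfun s a b k x)%:C *: gamma k).
  rewrite rmorph_sum/= scaler_suml scaler_sumr -big_split/=; apply: eq_bigr => k _.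
  rewrite sum_gamma; congr (_ + _).
  by rewrite rmorphM rmorph_nat scalerA.
rewrite sum_gamma_dkfun sum_ddkfun; [|lra|lra].
rewrite scalerDr !scalerA -!(rmorph_nat (real_complex R)) -!rmorphM/=.
rewrite addrA -scalerDl -rmorphD/=.
congr (_%:C *: _ + _%:C *: _); ring.
Qed.

Lemma pointwise_identity s l v a b x : 4 <= a -> 4 <= b ->
  a = l + v - n%:R -> b = - (v + 2^-1) ->
  - (2 * l%:C - n%:R - 1) *:
    (\sum_j (dkernel_coef s a b e j x)%:C *: gamma j)
  + \sum_k \sum_j (dkernel_coef s a b k j x)%:C *: (gamma k *m gamma e *m gamma j)
  + \sum_k \sum_j (ddkernel_coef (~~ s) (a + 1) b k j x)%:C *: gamma j =
  ((a * (v - l + 1)) * kfun (~~ s) (a - 1) true b x)%:C *: clifford gamma x.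
Proof.
move=> a4 b4 aE bE.
rewrite sum_gamma dirac_identity; [|lra|lra].
rewrite laplace_identity; [|lra|lra].
rewrite !negbK !addrK.
have -> : - (2 * l%:C - n%:R - 1) = (- (2 * l - n%:R - 1))%:C.
  by rewrite !(rmorphM, rmorphD, rmorphN, rmorph_nat, rmorph1)/=.
rewrite scalerDr !scalerA -!rmorphM/= !lin_comb.
rewrite -[RHS]addr0 -(scale0r (gamma e)) -[(0 : C)]/((0 : R)%:C).
set X := clifford gamma x.
(* Makes u / x_n and x_n u / |x|^2 the only functions left in the coefficient of X. *)
have y2E : kfun (~~ s) (a + 1) false (b - 1) x = x 0 e * kfun s a false (b - 1) x.
  by rewrite -kfun_lastc 1?mulrC//; lra.
have uE : kfun s a true b x = x 0 e * kfun (~~ s) (a - 1) true b x.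
  rewrite [RHS]mulrC -[x 0 e]/(lastc x) kfun_lastc ?negbK ?subrK//; lra.
have nE : n%:R = l + v - a by rewrite aE; ring.
have vE : v = - b - 2^-1 by rewrite bE; ring.
(* The coefficients of e_n and of x_n u / |x|^2 X both contain the factor 2 v + 1 + 2 b, which is
   zero by the definition of [b]. *)
congr (_%:C *: _ + _%:C *: _).
  by rewrite y2E /dkfun eqxx nE vE -[true%:R]/(1 : R); field.
by rewrite nE vE; field.
Qed.

Lemma spectral_shift_kernel s l v a b phi (T : functional R n N N) :
  4 <= a -> 4 <= b -> a = l + v - n%:R -> b = - (v + 2^-1) -> schwartz phi ->
  (forall psi, schwartz psi -> T psi = kernel_pairing s a b psi) ->
  spectral_shift gamma l%:C T phi =
  (a * (v - l + 1))%:C *: kernel_pairing (~~ s) (a - 1) b phi.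
Proof.
move=> a4 b4 aE bE sphi TE; rewrite spectral_shiftE.
have n0 j : nice (kernel_coef s a b j) by apply: nice_kernel_coef; lra.
have n1 k j : nice (dkernel_coef s a b k j) by apply: nice_dkernel_coef; lra.
have n2 k j : nice (ddkernel_coef (~~ s) (a + 1) b k j).
  by apply: nice_ddkernel_coef; lra.
have n3 j : nice (kernel_coef (~~ s) (a - 1) b j) by apply: nice_kernel_coef; lra.
have d0 k j x : is_derive x (delta_mx 0 k) (kernel_coef s a b j)
    (dkernel_coef s a b k j x) by apply: is_derive_kernel_coef; lra.
have TdE k : T (partial k phi) =
    - \sum_j pairing (dkernel_coef s a b k j) phi *: (gamma j *m P).
  rewrite TE; last exact: schwartz_partial.
  rewrite -sumrN; apply: eq_bigr => j _.
  by rewrite (pairing_by_parts (n0 j) (n1 k j) (d0 k j) sphi) scaleNr.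
have TlE k : T (laplace_test k phi) =
    \sum_j pairing (ddkernel_coef (~~ s) (a + 1) b k j) phi *: (gamma j *m P).
  rewrite TE; last exact: schwartz_laplace_test.
  by apply: eq_bigr => j _; rewrite pairing_laplace_test.
have -> : (2 * l%:C - n%:R - 1) *: T (partial ord_max phi)
    - \sum_k (gamma k *m gamma ord_max) *m T (partial k phi)
    + \sum_k T (laplace_test k phi) =
  - (2 * l%:C - n%:R - 1) *:
    (\sum_j pairing (dkernel_coef s a b e j) phi *: (gamma j *m P))
  + \sum_k \sum_j pairing (dkernel_coef s a b k j) phi *:
      (gamma k *m gamma e *m gamma j *m P)
  + \sum_k \sum_j pairing (ddkernel_coef (~~ s) (a + 1) b k j) phi *: (gamma j *m P).
  rewrite TdE scalerN -scaleNr -sumrN; congr (_ + _ + _).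
    apply: eq_bigr => k _; rewrite TdE mulmxN opprK mulmx_sumr.
    by apply: eq_bigr => j _; rewrite -scalemxAr !mulmxA.
  by apply: eq_bigr => k _; exact: TlE.
have term f A := @mx_integral_term R n N f A phi.
(* Both sides are now integrals against the same [phi], so comparing the integrands is enough. *)
apply: (mx_integral_unique (phi := phi)).
- apply: mx_integralD; first apply: mx_integralD.
  + apply: mx_integralZ; apply: mx_integral_sum => // j.
    exact: term (n1 e j) sphi.
  + apply: mx_integral_sum => // k; apply: mx_integral_sum => // j.
    exact: term (n1 k j) sphi.
  + apply: mx_integral_sum => // k; apply: mx_integral_sum => // j.
    exact: term (n2 k j) sphi.
- apply: mx_integralZ; apply: mx_integral_sum => // j.
  exact: term (n3 j) sphi.
move=> x /=.
(* The projection [P] factors out on the right, leaving an identity in the Clifford algebra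
   alone. *)
have fac (c : 'I_n -> C) (A : 'I_n -> 'M[C]_N) :
    \sum_j c j *: (A j *m P) = (\sum_j c j *: A j) *m P.
  by rewrite mulmx_suml; apply: eq_bigr => j _; rewrite scalemxAl.
have fac2 (c : 'I_n -> 'I_n -> C) (A : 'I_n -> 'I_n -> 'M[C]_N) :
    \sum_k \sum_j c k j *: (A k j *m P) = (\sum_k \sum_j c k j *: A k j) *m P.
  by rewrite mulmx_suml; apply: eq_bigr => k _; exact: fac.
rewrite (fac (fun j => (dkernel_coef s a b e j x)%:C) gamma).
rewrite (fac (fun j => (kernel_coef (~~ s) (a - 1) b j x)%:C) gamma).
rewrite (fac2 (fun k j => (dkernel_coef s a b k j x)%:C)
  (fun k j => gamma k *m gamma e *m gamma j)).
rewrite (fac2 (fun k j => (ddkernel_coef (~~ s) (a + 1) b k j x)%:C) (fun _ => gamma)).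
rewrite !scalemxAl -!mulmxDl (pointwise_identity s x a4 b4 aE bE).
congr (_ *m _); rewrite rmorphM -scalerA; congr (_ *: _).
by rewrite /clifford scaler_sumr; apply: eq_bigr => j _; rewrite scalerA -rmorphM.
Qed.

End ShiftIdentity.

Theorem theorem3p12 (R : realType) (m N : nat) (hn : (2 <= m.+1)%N)
    (gamma : 'I_m.+1 -> 'M[R[i]]_N)
    (hgamma : irreducible_clifford_module gamma)
    (K : bool -> R[i] -> R[i] -> functional R m.+1 N N)
    (hK : forall s : bool, kernel_family gamma s (K s)) :
  forall s : bool,
    meromorphic_eq
      (fun l v => spectral_shift gamma l (K s l v))
      (fun l v => dist_scale ((l + v - m.+1%:R) * (v - l + 1))
                             (K (~~ s) (l - 1) v)).
Proof.
move=> s; have [_ cliff _] := hgamma.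
have [mS hS] := hK s; have [mT hT] := hK (~~ s).
(* Chosen so that [a = b = 6] at the base point. Perturbations below 1 keep [a] and [b] above 4, as
   the two derivatives demand. *)
pose l1 : R := m.+1%:R + 25 / 2; pose v1 : R := - (13 / 2).
apply: (@continuation R m.+1 N N _ _ l1%:C v1%:C).
  apply: spectral_shift_local => // l v.
  apply: analytic_mul.
    apply: analytic_add; last exact: analytic_cst.
    by apply: analytic_add; [exact: analytic_fst|exact: analytic_snd].
  apply: analytic_add; last exact: analytic_cst.
  apply: analytic_add; first exact: analytic_snd.
  have -> : (fun l _ : R[i] => - l) = (fun l _ => (-1) * l).
    by apply/funext => l'; apply/funext => ?; rewrite mulN1r.
  by apply: analytic_mul; [exact: analytic_cst|exact: analytic_fst].
exists 1 => // x y; rewrite !ltr_norml => /andP[x1 x2] /andP[y1 y2] phi sphi.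
rewrite -!rmorphD/=; set l := l1 + x; set v := v1 + y.
pose a := l + v - m.+1%:R; pose b := - (v + 2^-1).
have aE : a = 6 + x + y by rewrite /a /l /v /l1 /v1; field.
have bE : b = 6 - y by rewrite /b /v /v1; field.
have a4 : 4 <= a by rewrite aE; lra.
have b4 : 4 <= b by rewrite bE; lra.
have n0 : 0 <= m.+1%:R :> R by rewrite ler0n.
have lvD : l + v = a + m.+1%:R by rewrite /a; ring.
(* With [lvD] this places [(l, v)] and [(l - 1, v)] in the domain of local integrability, where both
   families are given by their kernels. *)
have lvB : l - v = a + m.+1%:R + 2 * b + 1 by rewrite /a /b; field.
rewrite (@spectral_shift_kernel R m N gamma cliff s l v a b)//; last first.
  move=> psi spsi; rewrite hS//.
  - by rewrite (kernel_functionalE gamma s (l := l) (v := v) (a := a) (b := b))//; lra.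
  - by rewrite -rmorphD/= lvD; lra.
  - by rewrite -rmorphB/= lvB; lra.
rewrite /dist_scale.
have -> : l%:C - 1 = (l - 1)%:C by rewrite rmorphB rmorph1.
rewrite hT//.
- rewrite (kernel_functionalE gamma (~~ s) (l := l - 1) (v := v) (a := a - 1) (b := b))//;
    [|lra|lra|by rewrite /a; ring].
  congr (_ *: _); rewrite /a.
  by rewrite !(rmorphM, rmorphD, rmorphN, rmorph_nat, rmorph1)/=.
- rewrite -rmorphD/= addrAC lvD; lra.
- rewrite -rmorphB/= addrAC lvB; lra.
Qed.
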